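(* Let $\mathcal{H}$ be an essential non-central hyperplane arrangement in $\mathbb{R}^n$ with intersection lattice $\mathcal{L}$. Let $c=\{\hat0=x_0<x_1<\dots<x_k=\hat1\}$ be a chain in $\mathcal{L}\cup\{\hat0\}$ with $k\ge2$. Then the number of chains $d=\{y_0<y_1<\dots<y_k\}$ in $Q$ with $z_{ub}(y_i)=x_i$ for all $i$ is $$|z_{ub}^{-1}(c)|=\prod_{i=2}^{k-1}Z([x_{i-1},x_i])\cdot Z_{ub}([x_{k-1},x_k]).$$
   Context: A hyperplane arrangement is a finite set of affine hyperplanes in $\mathbb{R}^n$; it is essential if the normals span $\mathbb{R}^n$ and non-central if the intersection of all its hyperplanes is empty. The intersection lattice $\mathcal{L}$ consists of all nonempty intersections of subsets of the hyperplanes (the empty intersection being $\mathbb{R}^n$) together with $\emptyset$ as maximum, ordered by reverse inclusion, with ranks $\rho(x)=n-\dim x$, $\rho(\emptyset)=n+1$. $\mathcal{L}\cup\{\hat0\}$ is $\mathcal{L}$ with a new minimum $\hat0$ and all other ranks increased by 1; its maximum $\hat1$ is $\emptyset$. The faces of $\mathcal{H}$ are the nonempty relatively open cells of the induced decomposition of $\mathbb{R}^n$; the face lattice $T$ consists of the faces together with an empty face (minimum) and a maximum, ordered by $F\le G$ iff $F\subseteq\bar G$; $T^*$ is its dual, ranked so that its minimum has rank $0$, a face of dimension $i$ has rank $n+1-i$, and its maximum (the empty face) has rank $n+2$. $Q$ is the subposet of $T^*$ consisting of its minimum and all unbounded faces, together with an adjoined maximum of rank $n+2$; elements keep their $T^*$-ranks.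 $z_{ub}:Q\to\mathcal{L}\cup\{\hat0\}$ sends the minimum to $\hat0$, each face to its affine hull, and the maximum to $\emptyset$. For an interval $[x,y]$ with Möbius function $\mu$: $Z([x,y])=\sum_{x\le w\le y}(-1)^{\rho(w)-\rho(x)}\mu(x,w)$, $Z_b([x,y])=(-1)^{\rho(y)-\rho(x)}\mu(x,y)$, and $Z_{ub}=Z-2Z_b$. *)

(* Defs.v *)
From HB Require Import structures.
From mathcomp Require Import all_boot all_order all_algebra finmap.
From mathcomp Require Import all_classical all_reals.
From mathcomp Require Import topology normedtype lra.

Set Implicit Arguments.
Unset Strict Implicit.
Unset Printing Implicit Defensive.

Import Order.TTheory GRing.Theory Num.Theory.
Import numFieldNormedType.Exports.

Local Open Scope classical_set_scope.
Local Open Scope ring_scope.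

(* The Moebius function of a finite poset.  The first argument of [mobius_rec]
   is only fuel for the recursion on the second endpoint; [mobiusxx] and
   [mobius_sum] below are the defining equations. *)

Fixpoint mobius_rec (f : nat) (d : Order.disp_t) (P : finPOrderType d)
    (x y : P) : int :=
  if f is f'.+1 then
    if x == y then 1
    else if (x < y)%O then - \sum_(z : P | (x <= z < y)%O) mobius_rec f' x z
    else 0
  else 0.

Definition mobius (d : Order.disp_t) (P : finPOrderType d) (x y : P) : int :=
  mobius_rec #|P| x y.

Definition Zint (d : Order.disp_t) (P : finPOrderType d) (rho : P -> nat)
    (x y : P) : int :=
  \sum_(w : P | (x <= w <= y)%O) (-1) ^+ (rho w - rho x)%N * mobius x w.

Definition Zint_b (d : Order.disp_t) (P : finPOrderType d) (rho : P -> nat)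
    (x y : P) : int :=
  (-1) ^+ (rho y - rho x)%N * mobius x y.

Definition Zint_ub (d : Order.disp_t) (P : finPOrderType d) (rho : P -> nat)
    (x y : P) : int :=
  Zint rho x y - 2 * Zint_b rho x y.

Lemma mobius_recE (d : Order.disp_t) (P : finPOrderType d) (x : P) (f g : nat)
    (y : P) :
  (#|[pred z : P | (x <= z <= y)%O]| <= f)%N -> (f <= g)%N ->
  mobius_rec f x y = mobius_rec g x y.
Proof.
elim: f g y => [|f IHf] [|g] y //=.
- rewrite leqn0 => /eqP/card0_eq c0 _; have := c0 x; have := c0 y.
  rewrite !inE !lexx andbT /= => xy0.
  case: eqP => [xy|_]; first by rewrite xy lexx in xy0.
  by move=> _; case: ifP => // /ltW; rewrite xy0.
- move=> cf fg; case: eqP => // _; case: ifP => // xy; congr (- _).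
  apply: eq_bigr => z /andP[xz zy]; apply: IHf => //.
  rewrite -ltnS; apply: leq_trans cf; apply: proper_card.
  apply/properP; split.
    apply/fintype.subsetP => w; rewrite !inE => /andP[-> wz].
    exact: le_trans wz (ltW zy).
  exists y; rewrite !inE; first by rewrite (ltW xy) lexx.
  by rewrite (lt_geF zy) andbF.
Qed.

Lemma mobiusxx (d : Order.disp_t) (P : finPOrderType d) (x : P) :
  mobius x x = 1.
Proof.
rewrite /mobius; have : (0 < #|P|)%N by apply/card_gt0P; exists x.
by case: #|P| => //= f _; rewrite eqxx.
Qed.

Lemma mobius_sum (d : Order.disp_t) (P : finPOrderType d) (x y : P) :
  (x < y)%O -> \sum_(z : P | (x <= z <= y)%O) mobius x z = 0.
Proof.
move=> xy; rewrite (bigD1 y) /=; last by rewrite (ltW xy) lexx.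
have -> : mobius x y = - \sum_(z : P | (x <= z < y)%O) mobius x z.
  rewrite /mobius (@mobius_recE _ _ x #|P| #|P|.+1 y) ?max_card //=.
  by rewrite (lt_eqF xy) xy.
apply/eqP; rewrite addrC subr_eq0; apply/eqP; apply: eq_bigl => z.
by rewrite lt_neqAle -andbA [X in _ && X]andbC.
Qed.

Variant with_bot (P : Type) : Type := Bot | BElt of P.
Variant with_top (P : Type) : Type := Top | TElt of P.
Arguments Bot {P}.
Arguments Top {P}.

Definition option_of_with_bot (P : Type) (x : with_bot P) : option P :=
  if x is BElt a then Some a else None.
Definition with_bot_of_option (P : Type) (x : option P) : with_bot P :=
  if x is Some a then BElt a else Bot.
Lemma option_of_with_botK (P : Type) :
  cancel (@option_of_with_bot P) (@with_bot_of_option P).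
Proof. by case. Qed.
HB.instance Definition _ (P : finType) :=
  Finite.copy (with_bot P) (can_type (@option_of_with_botK P)).

Definition option_of_with_top (P : Type) (x : with_top P) : option P :=
  if x is TElt a then Some a else None.
Definition with_top_of_option (P : Type) (x : option P) : with_top P :=
  if x is Some a then TElt a else Top.
Lemma option_of_with_topK (P : Type) :
  cancel (@option_of_with_top P) (@with_top_of_option P).
Proof. by case. Qed.
HB.instance Definition _ (P : finType) :=
  Finite.copy (with_top P) (can_type (@option_of_with_topK P)).

Definition with_bot_le (d : Order.disp_t) (P : finPOrderType d)
    (x y : with_bot P) : bool :=
  match x, y with
  | Bot, _ => true
  | BElt _, Bot => false
  | BElt a, BElt b => (a <= b)%O
  end.

Lemma with_bot_le_refl (d : Order.disp_t) (P : finPOrderType d) :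
  reflexive (@with_bot_le d P).
Proof. by case=> //= a; exact: lexx. Qed.
Lemma with_bot_le_anti (d : Order.disp_t) (P : finPOrderType d) :
  antisymmetric (@with_bot_le d P).
Proof. by case=> [|a] [|b] //= /le_anti ->. Qed.
Lemma with_bot_le_trans (d : Order.disp_t) (P : finPOrderType d) :
  transitive (@with_bot_le d P).
Proof. by case=> [|a] [|b] [|c] //=; exact: le_trans. Qed.
HB.instance Definition _ (d : Order.disp_t) (P : finPOrderType d) :=
  Order.Le_isPOrder.Build d (with_bot P) (@with_bot_le_refl d P)
    (@with_bot_le_anti d P) (@with_bot_le_trans d P).

Definition with_top_le (d : Order.disp_t) (P : finPOrderType d)
    (x y : with_top P) : bool :=
  match x, y with
  | _, Top => true
  | Top, TElt _ => false
  | TElt a, TElt b => (a <= b)%O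
  end.

Lemma with_top_le_refl (d : Order.disp_t) (P : finPOrderType d) :
  reflexive (@with_top_le d P).
Proof. by case=> //= a; exact: lexx. Qed.
Lemma with_top_le_anti (d : Order.disp_t) (P : finPOrderType d) :
  antisymmetric (@with_top_le d P).
Proof. by case=> [|a] [|b] //= /le_anti ->. Qed.
Lemma with_top_le_trans (d : Order.disp_t) (P : finPOrderType d) :
  transitive (@with_top_le d P).
Proof. by case=> [|a] [|b] [|c] //=; exact: le_trans. Qed.
HB.instance Definition _ (d : Order.disp_t) (P : finPOrderType d) :=
  Order.Le_isPOrder.Build d (with_top P) (@with_top_le_refl d P)
    (@with_top_le_anti d P) (@with_top_le_trans d P).

Definition dot (R : realType) (n : nat) (u v : 'rV[R]_n) : R :=
  \sum_j u ord0 j * v ord0 j.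

Definition affine_hull (R : realType) (n : nat) (S : set 'rV[R]_n) :
    set 'rV[R]_n :=
  [set p | exists (k : nat) (x : 'I_k -> 'rV[R]_n) (a : 'I_k -> R),
     [/\ forall i, S (x i), \sum_i a i = 1 & p = \sum_i a i *: x i]].

(* The dimension of a nonempty affine subspace is that of its (unique)
   direction space; the value at other sets is irrelevant. *)
Definition affine_dim (R : realType) (n : nat) (S : set 'rV[R]_n) : nat :=
  \dim (xget 0%VS [set V : {vspace 'rV[R]_n} |
                   exists p, S = [set q | q - p \in V]]).

(* Finite sets of hyperplanes {x | normal i . x = offset i}, without
   repetition. *)
Record arrangement (R : realType) (n : nat) := Arrangement {
  nhyp : nat;
  normal : 'I_nhyp -> 'rV[R]_n;
  offset : 'I_nhyp -> R;
  normal_neq0 : forall i, normal i != 0;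
  hyperplane_inj :
    injective (fun i => [set x : 'rV[R]_n | dot (normal i) x = offset i])
}.

Definition hyperplane (R : realType) (n : nat) (A : arrangement R n)
    (i : 'I_(nhyp A)) : set 'rV[R]_n :=
  [set x | dot (normal i) x = offset i].

Definition essential (R : realType) (n : nat) (A : arrangement R n) : Prop :=
  <<[seq normal i | i : 'I_(nhyp A)]>>%VS = fullv.

Definition noncentral (R : realType) (n : nat) (A : arrangement R n) : Prop :=
  \bigcap_(i in [set: 'I_(nhyp A)]) hyperplane i = set0.

Definition flat (R : realType) (n : nat) (A : arrangement R n)
    (B : {set 'I_(nhyp A)}) : set 'rV[R]_n :=
  \bigcap_(i in [set i | i \in B]) hyperplane i.

(* Intersections of subfamilies that happen to be empty contribute the same
   element [set0] as the adjoined maximum. *)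
Definition flats (R : realType) (n : nat) (A : arrangement R n) :
    {fset (set 'rV[R]_n)} :=
  (set0 |` [fset flat B | B : {set 'I_(nhyp A)}])%fset.

Definition int_lattice (R : realType) (n : nat) (A : arrangement R n) : Type :=
  flats A.
HB.instance Definition _ (R : realType) (n : nat) (A : arrangement R n) :=
  Finite.copy (int_lattice A) (flats A).

Definition int_lattice_le (R : realType) (n : nat) (A : arrangement R n)
    (x y : int_lattice A) : bool :=
  `[< fsval y `<=` fsval x >].

Lemma int_lattice_le_refl (R : realType) (n : nat) (A : arrangement R n) :
  reflexive (@int_lattice_le R n A).
Proof. by move=> x; apply/asboolP. Qed.
Lemma int_lattice_le_anti (R : realType) (n : nat) (A : arrangement R n) :
  antisymmetric (@int_lattice_le R n A).
Proof.
move=> x y /andP[/asboolP yx /asboolP xy].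
by apply/val_inj/seteqP; split.
Qed.
Lemma int_lattice_le_trans (R : realType) (n : nat) (A : arrangement R n) :
  transitive (@int_lattice_le R n A).
Proof.
move=> y x z /asboolP yx /asboolP zy; apply/asboolP.
exact: subset_trans zy yx.
Qed.
HB.instance Definition _ (R : realType) (n : nat) (A : arrangement R n) :=
  Order.Le_isPOrder.Build Order.default_display (int_lattice A)
    (@int_lattice_le_refl R n A) (@int_lattice_le_anti R n A)
    (@int_lattice_le_trans R n A).

Lemma set0_flats (R : realType) (n : nat) (A : arrangement R n) :
  set0 \in flats A.
Proof. by rewrite !inE eqxx. Qed.

Definition empty_flat (R : realType) (n : nat) (A : arrangement R n) :
    int_lattice A :=
  [` set0_flats A]%fset.

Definition int_rank (R : realType) (n : nat) (A : arrangement R n)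
    (x : int_lattice A) : nat :=
  if x == empty_flat A then n.+1 else (n - affine_dim (fsval x))%N.

Definition int_lattice0 (R : realType) (n : nat) (A : arrangement R n) : Type :=
  with_bot (int_lattice A).
HB.instance Definition _ (R : realType) (n : nat) (A : arrangement R n) :=
  Order.FinPOrder.copy (int_lattice0 A) (with_bot (int_lattice A)).

Definition hat0 (R : realType) (n : nat) (A : arrangement R n) :
    int_lattice0 A := Bot.
Definition hat1 (R : realType) (n : nat) (A : arrangement R n) :
    int_lattice0 A := BElt (empty_flat A).

Definition int_rank0 (R : realType) (n : nat) (A : arrangement R n)
    (x : int_lattice0 A) : nat :=
  if x is BElt y then (int_rank y).+1 else 0%N.

(* A sign vector s prescribes for each hyperplane whether a point lies
   on it ([None]) or strictly on one of its sides ([Some _]). *)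

Definition open_side (R : realType) (n : nat) (A : arrangement R n)
    (i : 'I_(nhyp A)) (s : option bool) : set 'rV[R]_n :=
  match s with
  | None => hyperplane i
  | Some true => [set x | offset i < dot (normal i) x]
  | Some false => [set x | dot (normal i) x < offset i]
  end.

Definition cell (R : realType) (n : nat) (A : arrangement R n)
    (s : {ffun 'I_(nhyp A) -> option bool}) : set 'rV[R]_n :=
  \bigcap_(i in [set: 'I_(nhyp A)]) open_side i (s i).

Definition faces (R : realType) (n : nat) (A : arrangement R n) :
    {fset (set 'rV[R]_n)} :=
  ([fset cell s | s : {ffun 'I_(nhyp A) -> option bool}] `\ set0)%fset.

Definition face (R : realType) (n : nat) (A : arrangement R n) : Type :=
  faces A.
HB.instance Definition _ (R : realType) (n : nat) (A : arrangement R n) :=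
  Finite.copy (face A) (faces A).

Definition face_le (R : realType) (n : nat) (A : arrangement R n)
    (F G : face A) : bool :=
  `[< fsval F `<=` closure (fsval G) >].

Lemma face_le_refl (R : realType) (n : nat) (A : arrangement R n) :
  reflexive (@face_le R n A).
Proof. by move=> F; apply/asboolP; exact: subset_closure. Qed.

Lemma face_le_trans (R : realType) (n : nat) (A : arrangement R n) :
  transitive (@face_le R n A).
Proof.
move=> G F H /asboolP FG /asboolP GH; apply/asboolP.
apply: (subset_trans FG).
rewrite [X in _ `<=` X](closure_id _).1; last exact: closed_closure.
exact: closureS.
Qed.

Lemma faceP (R : realType) (n : nat) (A : arrangement R n) (F : face A) :
  (exists s, fsval F = cell (A := A) s) /\ fsval F !=set0.
Proof.
have := fsvalP F; rewrite !inE => /andP[/set0P F0 /imfsetP[s _ Fs]].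
by split=> //; exists s.
Qed.

Lemma dot_continuous (R : realType) (n : nat) (u : 'rV[R]_n) :
  continuous (dot u).
Proof.
apply: continuous_big => [|j _]; first exact: add_continuous.
move=> x; apply: (@continuousM R 'rV[R]_n (fun=> u ord0 j)
  (fun v : 'rV[R]_n => v ord0 j)); first exact: cst_continuous.
exact: coord_continuous.
Qed.

Lemma dotD (R : realType) (n : nat) (u x y : 'rV[R]_n) :
  dot u (x + y) = dot u x + dot u y.
Proof. by rewrite -big_split; apply: eq_bigr => j _; rewrite mxE mulrDr. Qed.

Lemma dotZ (R : realType) (n : nat) (u : 'rV[R]_n) (a : R) (x : 'rV[R]_n) :
  dot u (a *: x) = a * dot u x.
Proof. by rewrite /dot mulr_sumr; apply: eq_bigr => j _; rewrite mxE mulrCA. Qed.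

Lemma dot_sum (R : realType) (n : nat) (u : 'rV[R]_n) (k : nat)
    (x : 'I_k -> 'rV[R]_n) : dot u (\sum_i x i) = \sum_i dot u (x i).
Proof.
apply: (big_morph (dot u) (dotD u)).
by apply: big1 => j _; rewrite mxE mulr0.
Qed.

Definition closed_side (R : realType) (n : nat) (A : arrangement R n)
    (i : 'I_(nhyp A)) (s : option bool) : set 'rV[R]_n :=
  match s with
  | None => hyperplane i
  | Some true => [set x | offset i <= dot (normal i) x]
  | Some false => [set x | dot (normal i) x <= offset i]
  end.

Lemma closed_closed_side (R : realType) (n : nat) (A : arrangement R n)
    (i : 'I_(nhyp A)) (s : option bool) : closed (closed_side i s).
Proof.
have cd := @dot_continuous R n (normal i).
case: s => [[]|] /=.
- by apply: (@preimage_closed _ _ (dot (normal i)) [set y | offset i <= y]);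
    [move=> *; exact: cd | exact: closed_ge].
- by apply: (@preimage_closed _ _ (dot (normal i)) [set y | y <= offset i]);
    [move=> *; exact: cd | exact: closed_le].
- by apply: (@preimage_closed _ _ (dot (normal i)) [set y | y = offset i]);
    [move=> *; exact: cd | exact: closed_eq].
Qed.

Lemma closure_cell (R : realType) (n : nat) (A : arrangement R n)
    (s : {ffun 'I_(nhyp A) -> option bool}) (i : 'I_(nhyp A)) :
  closure (cell s) `<=` closed_side i (s i).
Proof.
rewrite [X in _ `<=` X](closure_id _).1; last exact: closed_closed_side.
apply: closureS => x /(_ i I); case: (s i) => [[]|] //=; exact: ltW.
Qed.

Lemma face_le_anti (R : realType) (n : nat) (A : arrangement R n) :
  antisymmetric (@face_le R n A).
Proof.
move=> F G /andP[/asboolP FG /asboolP GF].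
have [[s Fs] [x Fx]] := faceP F; have [[t Gt] [y Gy]] := faceP G.
apply: val_inj; rewrite /= Fs Gt; congr cell; apply/ffunP => i.
move/FG: (Fx); move/GF: (Gy); rewrite Fs Gt => /(@closure_cell _ _ _ _ i) ys.
move=> /(@closure_cell _ _ _ _ i) xt.
move: Fx Gy; rewrite Fs Gt => /(_ i I) xs /(_ i I) yt; move: xs yt ys xt.
clear FG GF Fs Gt.
case: (s i) => [[]|]; case: (t i) => [[]|] //=; rewrite /hyperplane /= =>
  *; exfalso; lra.
Qed.

HB.instance Definition _ (R : realType) (n : nat) (A : arrangement R n) :=
  Order.Le_isPOrder.Build Order.default_display (face A)
    (@face_le_refl R n A) (@face_le_anti R n A) (@face_le_trans R n A).

(* The face lattice T: [Bot] is the empty face.  Its dual T^* is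
   [(face_lattice A)^d], whose minimum is [BElt Top] and whose maximum is the
   empty face [Bot]. *)
Definition face_lattice (R : realType) (n : nat) (A : arrangement R n) : Type :=
  with_bot (with_top (face A)).
HB.instance Definition _ (R : realType) (n : nat) (A : arrangement R n) :=
  Order.FinPOrder.copy (face_lattice A) (with_bot (with_top (face A))).

Lemma affine_hull_cell (R : realType) (n : nat) (A : arrangement R n)
    (s : {ffun 'I_(nhyp A) -> option bool}) :
  cell s !=set0 ->
  affine_hull (cell s) = flat [set i | s i == None]%SET.
Proof.
move=> [x0 sx0]; apply/seteqP; split=> p.
  move=> [k [x [a [xs a1 ->]]]] i /=; rewrite inE => /eqP si.
  rewrite /hyperplane /= dot_sum -[RHS]mul1r -a1 mulr_suml.
  apply: eq_bigr => j _; rewrite dotZ.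
  by have := xs j i I; rewrite si /= => ->.
move=> sp.
have [e e0 se] : exists2 e : R, e != 0 & cell s (x0 + e *: (p - x0)).
  suff : \forall e \near 0^'+, cell s (x0 + e *: (p - x0)).
    move=> H; have : \forall e \near (0 : R)^'+, e != 0 /\ cell s (x0 + e *: (p - x0)).
      near=> e; split; last by near: e.
      by rewrite gt_eqF//; near: e; exact: nbhs_right_gt.
    by move=> /filter_ex[e []]; exists e.
  suff : \forall e \near 0^'+, forall i : 'I_(nhyp A),
      open_side i (s i) (x0 + e *: (p - x0)).
    by apply: filterS => e H i _; exact: H.
  apply: filter_forall => i.
  have dE (e : R) : dot (normal i) (x0 + e *: (p - x0)) =
      dot (normal i) x0 + e * dot (normal i) (p - x0) by rewrite dotD dotZ.
  have cvgd : dot (normal i) x0 + e * dot (normal i) (p - x0) @[e --> (0 : R)^'+]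
      --> dot (normal i) x0.
    rewrite -[X in _ --> X]addr0 -[X in _ --> _ + X](mul0r (dot (normal i) (p - x0))).
    apply: cvgD; first exact: cvg_cst.
    apply: cvgM; last exact: cvg_cst.
    by apply: cvg_at_right_filter; exact: cvg_id.
  have := sx0 i I; have := sp i; rewrite /= inE.
  case: (s i) => [[]|] /= => [_ lt0|_ lt0|/(_ isT) pi x0i].
  - near=> e; rewrite /= dE; near: e.
    exact: (cvgr_gt _ cvgd).
  - near=> e; rewrite /= dE; near: e.
    exact: (cvgr_lt _ cvgd).
  - near=> e; rewrite /hyperplane /= dotD dotZ.
    have -> : p - x0 = p + (-1) *: x0 by rewrite scaleN1r.
    by rewrite dotD dotZ pi x0i mulN1r subrr mulr0 addr0.
exists 2%N, (fun i => if i == ord0 then x0 else x0 + e *: (p - x0)),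
  (fun i => if i == ord0 then 1 - e^-1 else e^-1); split.
- by move=> i; case: ifP.
- by rewrite !big_ord_recl big_ord0 /= addr0 subrK.
- rewrite !big_ord_recl big_ord0 /= addr0 scalerDr scalerA mulVf// scale1r.
  by rewrite addrA -scalerDl subrK scale1r addrC subrK.
Unshelve. all: by end_near. Qed.

Lemma affine_hull_face (R : realType) (n : nat) (A : arrangement R n)
    (F : face A) : affine_hull (fsval F) \in flats A.
Proof.
have [[s Fs] F0] := faceP F; rewrite Fs in F0 *.
rewrite affine_hull_cell// !inE; apply/orP; right.
by apply/imfsetP; exists [set i | s i == None]%SET.
Qed.

Definition face_hull (R : realType) (n : nat) (A : arrangement R n)
    (F : face A) : int_lattice A :=
  [` affine_hull_face F]%fset.

(* On T^*; [z_ub] is its restriction to the unbounded part, extended to the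
   adjoined maximum. *)
Definition zmap (R : realType) (n : nat) (A : arrangement R n)
    (t : (face_lattice A)^d) : int_lattice0 A :=
  match t with
  | BElt Top => hat0 A
  | BElt (TElt F) => BElt (face_hull F)
  | Bot => hat1 A
  end.

Definition min_or_unbounded (R : realType) (n : nat) (A : arrangement R n)
    (t : (face_lattice A)^d) : bool :=
  match t with
  | BElt Top => true
  | BElt (TElt F) => `[< ~ bounded_set (fsval F) >]
  | Bot => false
  end.

Record unbounded_part (R : realType) (n : nat) (A : arrangement R n) :=
  UnboundedPart {
    ub_val : (face_lattice A)^d;
    ub_valP : min_or_unbounded ub_val
  }.
HB.instance Definition _ (R : realType) (n : nat) (A : arrangement R n) :=
  [isSub for @ub_val R n A].
HB.instance Definition _ (R : realType) (n : nat) (A : arrangement R n) :=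
  [Finite of unbounded_part A by <:].
HB.instance Definition _ (R : realType) (n : nat) (A : arrangement R n) :=
  [SubChoice_isSubPOrder of unbounded_part A by <:
     with Order.default_display].

Definition Qposet (R : realType) (n : nat) (A : arrangement R n) : Type :=
  with_top (unbounded_part A).
HB.instance Definition _ (R : realType) (n : nat) (A : arrangement R n) :=
  Order.FinPOrder.copy (Qposet A) (with_top (unbounded_part A)).

Definition z_ub (R : realType) (n : nat) (A : arrangement R n)
    (q : Qposet A) : int_lattice0 A :=
  if q is TElt t then zmap (ub_val t) else hat1 A.

(* Main.v *)
(* For a nonempty flat X, three alternating sums of (-1)^dim F are evaluated:
   over all faces F in X the sum is (-1)^dim X; over the faces F of X whose
   closure contains a fixed face G it is again (-1)^dim X; over the bounded
   faces in X it is 1 (the arrangement being essential).  All three are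
   instances of one principle: a function of polyhedral cells that is additive
   whenever a hyperplane cuts a cell into three pieces equals the sum of its
   values over the faces contained in the cell.  The additive functions used are
   (-1)^dim C, and the function that is (-1)^(dim C - dim L) when the recession
   cone of C is its lineality space L and 0 otherwise.  Moebius inversion over
   an interval of the intersection lattice turns these sums into Zaslavsky's
   counts: Z([X, aff G]) faces with hull X have G in their closure, and
   Z_ub([X, 1]) faces with hull X are unbounded.  A chain in the fibre is built
   from the top downwards; a face whose closure contains an unbounded face is
   unbounded, so the numbers of choices multiply. *)
Require Import Defs.
From HB Require Import structures.
From mathcomp Require Import all_boot all_order all_algebra finmap.
From mathcomp Require Import all_classical all_reals.
From mathcomp Require Import topology normedtype derive ring lra zify.

Set Implicit Arguments.
Unset Strict Implicit.
Unset Printing Implicit Defensive.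

Import Order.TTheory GRing.Theory Num.Theory.
Import numFieldNormedType.Exports.

Local Open Scope ring_scope.

(** * Moebius inversion and counting of chains *)

(** After the two sums are exchanged, the coefficient of [g w] is the sum of [mobius x z] over
    [x <= z <= w], which vanishes unless [w = x]. *)
Lemma mobius_inversion (d : Order.disp_t) (P : finPOrderType d)
    (f g : P -> int) (x y : P) :
  (x <= y)%O ->
  (forall z, (x <= z <= y)%O -> \sum_(w : P | (z <= w <= y)%O) g w = f z) ->
  g x = \sum_(z : P | (x <= z <= y)%O) mobius x z * f z.
Proof.
move=> xy fE.
under eq_bigr => z zI do rewrite -fE// mulr_sumr.
rewrite (exchange_big_dep (fun w => (x <= w <= y)%O)) /=; last first.
  by move=> z w /andP[xz _] /andP[zw ->]; rewrite (le_trans xz zw).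
rewrite (bigD1 x) ?lexx//= (big_pred1 x) => [|z]; last first.
  by rewrite /= xy andbT [RHS]eq_le; case: (boolP (z <= x)%O) => zx;
    rewrite ?andbF// (le_trans zx xy) !andbT.
rewrite mobiusxx mul1r big1 ?addr0// => w /andP[/andP[xw wy] wx].
rewrite (eq_bigl (fun z => (x <= z <= w)%O)) => [|z].
  by rewrite -mulr_suml mobius_sum ?mul0r// lt_neqAle eq_sym wx.
rewrite wy andbT -!andbA; congr (_ && _).
by case: (boolP (z <= w)%O) => zw; rewrite ?andbF// (le_trans zw wy).
Qed.

(** By the second hypothesis the number of entries at level [i] below a given entry of level [i.+1]
    does not depend on that entry, so the counts multiply downwards from the single entry at level
    [k]. *)
Lemma card_sorted_fibers (T : finType) (e : rel T) (k : nat)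
    (p : nat -> pred T) (c : nat -> int) :
  #|p k| = 1%N ->
  (forall i y, (i < k)%N -> p i.+1 y -> #|[pred y' | p i y' && e y' y]|%:Z = c i) ->
  #|[pred t : k.+1.-tuple T | sorted e t && [forall i : 'I_k.+1, p i (tnth t i)]]|%:Z =
  \prod_(0 <= i < k) c i.
Proof.
elim: k p c => [|k IHk] p c p1 pc.
  have injs : {in p 0%N &, injective (fun y : T => [tuple y])} by move=> a b _ _ [].
  rewrite big_geq//; congr Posz; transitivity #|p 0%N|; last by [].
  rewrite -(card_in_imset injs).
  apply: fintype.eq_card => t; rewrite inE.
  apply/andP/imsetP => [[_ /forallP pt]|[y py ->]].
    exists (tnth t ord0); first by have := pt ord0.
    by apply/eqP; rewrite eqEtuple; apply/forallP=> i; rewrite (ord1 i).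
  by split=> //; apply/forallP => i; rewrite (ord1 i).
have {}IHk := IHk (fun i => p i.+1) (fun i => c i.+1) p1 (fun i y h => pc i.+1 y h).
rewrite big_nat_recl// -IHk -sum1_card.
rewrite (reindex (fun u : T * k.+1.-tuple T => [tuple of u.1 :: u.2])) /=; last first.
  exists (fun t => (thead t, [tuple of behead t])) => [[a t]|t] _ /=.
    by congr pair; apply: val_inj.
  by rewrite -tuple_eta.
rewrite (eq_bigl (fun u : T * k.+1.-tuple T =>
    (sorted e u.2 && [forall i : 'I_k.+1, p i.+1 (tnth u.2 i)]) &&
    (p 0%N u.1 && e u.1 (thead u.2)))); last first.
  move=> [a t] /=; rewrite inE /= [in LHS](tuple_eta t) /=.
  have -> : [forall i : 'I_k.+2,
      p i (tnth [tuple of a :: [tuple of thead t :: behead t]] i)] =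
     p 0%N a && [forall i : 'I_k.+1, p i.+1 (tnth t i)].
    apply/forallP/andP => [h|[h0 /forallP h] i].
      split; first by have := h ord0.
      by apply/forallP => i; have := h (lift ord0 i); rewrite tnthS -tuple_eta.
    case: (unliftP ord0 i) => [j|] ->; last by [].
    by rewrite tnthS -tuple_eta; exact: h.
  have -> : sorted e t = path e (thead t) (behead t) by rewrite [in LHS](tuple_eta t).
  by case: (e a _); case: (path _ _ _); case: (p _ _); rewrite ?andbF ?andbT.
rewrite (eq_bigl (fun u : T * k.+1.-tuple T =>
  (xpredT u.1) && ((sorted e u.2 && [forall i : 'I_k.+1, p i.+1 (tnth u.2 i)]) &&
    (p 0%N u.1 && e u.1 (thead u.2)))))//.
rewrite -(pair_big_dep xpredT (fun a (t : k.+1.-tuple T) =>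
    (sorted e t && [forall i : 'I_k.+1, p i.+1 (tnth t i)]) &&
    (p 0%N a && e a (thead t))) (fun _ _ => 1%N)) /=.
(* With the tail summed outermost, each admissible tail has [c 0] possible heads. *)
rewrite (exchange_big_dep (fun t : k.+1.-tuple T =>
    sorted e t && [forall i : 'I_k.+1, p i.+1 (tnth t i)])) /=; last first.
  by move=> a t _ /andP[].
under eq_bigr => t pt.
  rewrite (_ : \sum_(_ | _) _ = #|[pred y' | p 0%N y' && e y' (thead t)]|)%N.
    over.
  by rewrite -sum1_card; apply: eq_bigl => a; rewrite pt.
rewrite (big_morph Posz PoszD (erefl (Posz 0))) (eq_bigr (fun=> c 0%N)).
  by rewrite sumr_const -mulr_natr natz.
by move=> t /andP[_ /forallP/(_ ord0) pt]; exact: pc.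
Qed.

(** * Cells cut out by partial sign conditions *)

Lemma dotB (R : realType) (n : nat) (u x y : 'rV[R]_n) :
  dot u (x - y) = dot u x - dot u y.
Proof. by rewrite dotD -scaleN1r dotZ mulN1r. Qed.

Lemma dot_linear (R : realType) (n : nat) (u : 'rV[R]_n) :
  linear (dot u : 'rV[R]_n -> R^o).
Proof. by move=> a x y; rewrite dotD dotZ. Qed.

HB.instance Definition _ (R : realType) (n : nat) (u : 'rV[R]_n) :=
  GRing.isLinear.Build R 'rV[R]_n R^o _ (dot u) (dot_linear u).

Section SignConditions.
Variables (R : realType) (n : nat) (A : arrangement R n).
Local Notation I := 'I_(nhyp A).
Implicit Types (B D : {set I}) (s t : {ffun I -> option bool}) (i j : I)
  (o : option bool) (x y p v w : 'rV[R]_n).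

(** The direction space of [flat B] whenever that flat is nonempty. *)
Definition dirspace B : {vspace 'rV[R]_n} :=
  (\bigcap_(i in B) lker (linfun (dot (normal i) : 'rV[R]_n -> R^o)))%VS.

Lemma dirspaceP B v :
  reflect (forall i, i \in B -> dot (normal i) v = 0) (v \in dirspace B).
Proof.
apply: (iffP subv_bigcapP) => [h i iB|h i iB].
  by have := h i iB; rewrite -memvE memv_ker lfunE => /eqP.
by rewrite -memvE memv_ker lfunE; apply/eqP/h.
Qed.

Lemma dirspaceU1 j B :
  dirspace (j |: B) =
  (dirspace B :&: lker (linfun (dot (normal j) : 'rV[R]_n -> R^o)))%VS.
Proof.
apply/vspaceP => v; rewrite memv_cap memv_ker lfunE.
apply/dirspaceP/andP => [h|[/dirspaceP h /eqP hj] i].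
  split; last by apply/eqP/h; rewrite setU11.
  by apply/dirspaceP => i iB; apply: h; rewrite setU1r.
by rewrite !inE => /orP[/eqP ->|/h].
Qed.

Lemma dirspaceU1_id j B :
  (forall v, v \in dirspace B -> dot (normal j) v = 0) ->
  dirspace (j |: B) = dirspace B.
Proof.
move=> h; rewrite dirspaceU1; apply/capv_idPl/subvP => v /h hv.
by rewrite memv_ker lfunE /= hv.
Qed.

(** The form [dot (normal j)] is nonzero on [dirspace B], so its image there is a line and
    rank-nullity gives the drop by one. *)
Lemma dim_dirspaceU1 j B v : v \in dirspace B -> dot (normal j) v != 0 ->
  \dim (dirspace B) = (\dim (dirspace (j |: B))).+1.
Proof.
move=> vB hv; set f := linfun (dot (normal j) : 'rV[R]_n -> R^o).
rewrite dirspaceU1 -(limg_ker_dim f (dirspace B)) -[RHS]addn1; congr addn.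
apply/eqP; rewrite eqn_leq; apply/andP; split.
  by have := dimvS (subvf (f @: dirspace B)%VS); rewrite dimvf /dim /=.
rewrite lt0n dimv_eq0; apply: contraNN hv => /eqP f0.
by have := memv_img f vB; rewrite f0 memv0 lfunE.
Qed.

(** The pair [D], [s] encodes a relatively open cell of the subarrangement indexed by [D]; values of
    [s] outside [D] are ignored. Partial conditions allow hyperplanes to be added one at a time. *)
Definition sat D s x : Prop := forall i, i \in D -> open_side i (s i) x.

Definition satisfiable D s : bool := `[< exists x, sat D s x >].

Definition zeros D s : {set I} := [set i in D | s i == None]%SET.

(** The homogeneous weak form of [open_side]; imposed for all [i] in [D], it describes the recession
    cone of the closure of a nonempty cell. *)
Definition closed_side0 i o v : Prop :=
  match o with
  | None => dot (normal i) v = 0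
  | Some true => 0 <= dot (normal i) v
  | Some false => dot (normal i) v <= 0
  end.

Definition recession D s v : Prop := forall i, i \in D -> closed_side0 i (s i) v.

Definition upd s j o : {ffun I -> option bool} :=
  [ffun i => if i == j then o else s i].

Lemma updE s j o : upd s j o j = o.
Proof. by rewrite ffunE eqxx. Qed.

Lemma upd_neq s j o i : i != j -> upd s j o i = s i.
Proof. by rewrite ffunE => /negPf ->. Qed.

Lemma satU1 D s j o x : j \notin D ->
  sat (j |: D) (upd s j o) x <-> sat D s x /\ open_side j o x.
Proof.
move=> jD; split=> [h|[h hj] i].
  split=> [i iD|]; last by have := h j (setU11 _ _); rewrite updE.
  have := h i (setU1r _ iD); rewrite upd_neq//.
  by apply: contraNneq jD => <-.
rewrite !inE => /orP[/eqP ->|iD]; rewrite ?updE// upd_neq; first exact: h.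
by apply: contraNneq jD => <-.
Qed.

Lemma recessionU1 D s j o v : j \notin D ->
  recession (j |: D) (upd s j o) v <-> recession D s v /\ closed_side0 j o v.
Proof.
move=> jD; split=> [h|[h hj] i].
  split=> [i iD|]; last by have := h j (setU11 _ _); rewrite updE.
  have := h i (setU1r _ iD); rewrite upd_neq//.
  by apply: contraNneq jD => <-.
rewrite !inE => /orP[/eqP ->|iD]; rewrite ?updE// upd_neq; first exact: h.
by apply: contraNneq jD => <-.
Qed.

Lemma zerosU1 D s j o : j \notin D ->
  zeros (j |: D) (upd s j o) =
  if o == None then j |: zeros D s else zeros D s.
Proof.
move=> jD; apply/setP => i; rewrite !inE ffunE.
case: (eqVneq i j) => [->|ij] /=.
  by case: o => [b|]; rewrite !inE ?eqxx ?(negPf jD).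
by case: o => [b|]; rewrite !inE ?(negPf ij).
Qed.

Lemma dirspace_recession D s v : v \in dirspace D -> recession D s v.
Proof. by move=> /dirspaceP h i /h; rewrite /closed_side0; case: (s i) => [[]|] ->. Qed.

Lemma recessionD D s v w : recession D s v -> recession D s w ->
  recession D s (v + w).
Proof.
move=> hv hw i iD; move: (hv i iD) (hw i iD); rewrite /closed_side0 dotD.
by case: (s i) => [[]|] *; lra.
Qed.

Lemma recessionZ D s (a : R) v : 0 <= a -> recession D s v ->
  recession D s (a *: v).
Proof.
move=> a0 hv i iD; move: (hv i iD); rewrite /closed_side0 dotZ.
by case: (s i) => [[]|] *; nra.
Qed.

Lemma sat_recession D s x v : sat D s x -> recession D s v ->
  sat D s (x + v).
Proof.
move=> hx hv i iD; move: (hx i iD) (hv i iD); rewrite /closed_side0.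
by case: (s i) => [[]|]; rewrite /= /hyperplane /= dotD => *; lra.
Qed.

Lemma sat_sub_dirspace D s x y : sat D s x -> sat D s y ->
  y - x \in dirspace (zeros D s).
Proof.
move=> hx hy; apply/dirspaceP => i; rewrite inE => /andP[iD /eqP si].
move: (hx i iD) (hy i iD); rewrite si /= /hyperplane /= dotB => -> ->.
by rewrite subrr.
Qed.

Local Open Scope classical_set_scope.

(** Cells are relatively open: along [v] the equations persist exactly, and the finitely many strict
    inequalities persist for small [e]. *)
Lemma sat_open D s x v : sat D s x -> v \in dirspace (zeros D s) ->
  exists2 e : R, 0 < e & sat D s (x + e *: v).
Proof.
move=> sx /dirspaceP v0.
suff : \forall e \near (0 : R)^'+, forall i : I, i \in D ->
    open_side i (s i) (x + e *: v).
  move=> H; have : \forall e \near (0 : R)^'+, 0 < e /\ sat D s (x + e *: v).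
    near=> e; split; last by near: e.
    by near: e; exact: nbhs_right_gt.
  by move=> /filter_ex[e []]; exists e.
apply: filter_forall => i.
have [iD|iD] := boolP (i \in D); last by near=> e.
have dE (e : R) : dot (normal i) (x + e *: v) =
    dot (normal i) x + e * dot (normal i) v by rewrite dotD dotZ.
have cvgd : dot (normal i) x + e * dot (normal i) v @[e --> (0 : R)^'+]
    --> dot (normal i) x.
  rewrite -[X in _ --> X]addr0 -[X in _ --> _ + X](mul0r (dot (normal i) v)).
  apply: cvgD; first exact: cvg_cst.
  apply: cvgM; last exact: cvg_cst.
  by apply: cvg_at_right_filter; exact: cvg_id.
have := sx i iD; have := v0 i; rewrite inE iD /=.
case: (s i) => [[]|] /= => [_ lt0|_ lt0|/(_ isT) vi xi].
- near=> e; rewrite dE => _; near: e.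
  exact: (cvgr_gt _ cvgd).
- near=> e; rewrite dE => _; near: e.
  exact: (cvgr_lt _ cvgd).
- by near=> e; rewrite /hyperplane /= dE vi mulr0 addr0.
Unshelve. all: by end_near. Qed.

Local Close Scope classical_set_scope.

Definition touches D s j o : Prop := exists x, sat D s x /\ open_side j o x.

Lemma satisfiableU1 D s j o : j \notin D ->
  satisfiable (j |: D) (upd s j o) <-> touches D s j o.
Proof.
move=> jD; split=> [/asboolP[x /(satU1 _ _ _ jD) h]|[x h]]; first by exists x.
by apply/asboolP; exists x; apply/satU1.
Qed.

(** The segment from [q] to [p] can be prolonged slightly beyond [p] inside the cell, and there it
    has crossed the hyperplane. *)
Lemma touches_opp D s j b :
  touches D s j None -> touches D s j (Some b) -> touches D s j (Some (~~ b)).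
Proof.
move=> [p [sp pj]] [q [sq qj]].
have [e e0 se] := sat_open sp (sat_sub_dirspace sq sp).
exists (p + e *: (p - q)); split=> //.
by move: pj qj; case: b; rewrite /= /hyperplane /= => pj qj;
  rewrite dotD dotZ dotB pj; nra.
Qed.

Lemma touches_hyperplane D s j :
  touches D s j (Some true) -> touches D s j (Some false) -> touches D s j None.
Proof.
move=> [p [sp /= pj]] [q [sq /= qj]].
(* The distances of [p] and [q] from the hyperplane, up to a common factor; weighting each point by
   the distance of the other gives the crossing point, which lies in the cell by convexity. *)
pose a := dot (normal j) p - offset j; pose b := offset j - dot (normal j) q.
have a0 : 0 < a by rewrite subr_gt0.
have b0 : 0 < b by rewrite subr_gt0.
have c0 : 0 < (a + b)^-1 by rewrite invr_gt0 addr_gt0.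
have ab : (a + b) * (a + b)^-1 = 1 by rewrite mulfV// gt_eqF// addr_gt0.
pose l := b * (a + b)^-1; pose m := a * (a + b)^-1.
have l0 : 0 < l by rewrite mulr_gt0.
have m0 : 0 < m by rewrite mulr_gt0.
have lm : l + m = 1 by rewrite -mulrDl addrC.
exists (l *: p + m *: q); split=> [i iD|].
  move: (sp i iD) (sq i iD).
  have oE : offset i = l * offset i + m * offset i by rewrite -mulrDl lm mul1r.
  by case: (s i) => [[]|]; rewrite /= /hyperplane /= dotD !dotZ;
    [nra | nra | move=> -> ->].
rewrite /= /hyperplane /= dotD !dotZ.
have -> : dot (normal j) p = offset j + a by rewrite /a; ring.
have -> : dot (normal j) q = offset j - b by rewrite /b; ring.
have -> : l * (offset j + a) + m * (offset j - b) =
  (l + m) * offset j + (l * a - m * b) by ring.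
by rewrite lm /l /m; ring.
Qed.

Lemma touches_some D s j : satisfiable D s -> exists o, touches D s j o.
Proof.
move=> /asboolP[x sx].
have [h|h|h] := ltgtP (dot (normal j) x) (offset j).
- by exists (Some false), x.
- by exists (Some true), x.
- by exists None, x.
Qed.

Variant split_spec D s j : Prop :=
| SplitAll of (forall o, touches D s j o)
| SplitOne o of touches D s j o & (forall o', touches D s j o' -> o' = o).

(** A cell meeting the hyperplane and one open side meets the other side too, and a cell meeting
    both open sides meets the hyperplane; so it is cut in three or stays whole. *)
Lemma hyperplane_splitP D s j : satisfiable D s -> split_spec D s j.
Proof.
move=> sat_s.
have [h0|h0] := pselect (touches D s j None).
  have [[b hb]|hb] := pselect (exists b, touches D s j (Some b)).
    apply: SplitAll => -[b'|//]; have := touches_opp h0 hb.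
    by case: b hb; case: b'.
  by apply: (SplitOne h0) => -[b|//] h; case: hb; exists b.
have [[b|] hb] := touches_some j sat_s; last by case: h0.
apply: (SplitOne hb) => -[b'|//] hb'; congr Some.
case: b b' hb hb' => -[] // h1 h2; case: h0; exact: touches_hyperplane.
Qed.

End SignConditions.

(** * Additive functions of cells *)

Lemma sum_option_bool (V : nmodType) (f : option bool -> V) :
  \sum_o f o = f None + f (Some true) + f (Some false).
Proof.
rewrite (bigD1 None)//= (bigD1 (Some true))//= (bigD1 (Some false))//=.
by rewrite big_pred0 ?addr0 ?addrA// => -[[]|].
Qed.

Section Valuations.
Variables (R : realType) (n : nat) (A : arrangement R n).
Local Notation I := 'I_(nhyp A).
Implicit Types (B D : {set I}) (s t : {ffun I -> option bool}) (i j : I)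
  (o : option bool) (x y p v w : 'rV[R]_n).

Lemma only_touches_open_side D s j o x :
  (forall o', touches D s j o' -> o' = o) -> sat D s x -> open_side j o x.
Proof.
move=> only sx; have [o' hx] : exists o', open_side j o' x.
  have [h|h|h] := ltgtP (dot (normal j) x) (offset j).
  - by exists (Some false).
  - by exists (Some true).
  - by exists None.
by rewrite -(only o')//; exists x.
Qed.

(** A ray in a recession direction never leaves the cell, hence never leaves side [o]. *)
Lemma only_touches_closed_side0 D s j o v :
  (forall o', touches D s j o' -> o' = o) -> satisfiable D s ->
  recession D s v -> closed_side0 j o v.
Proof.
move=> only /asboolP[x sx] rv; have ox := only_touches_open_side only sx.
have oxv a : 0 <= a -> open_side j o (x + a *: v).
  by move=> a0; apply/(only_touches_open_side only)/sat_recession/recessionZ.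
case: o only ox oxv => [[]|] _ /=; last first.
- by move=> xj /(_ 1 ler01); rewrite /hyperplane /= scale1r dotD xj => *; lra.
- move=> xj oxv; rewrite leNgt; apply/negP => vj.
  (* The parameter at which the ray from [x] along [v] would hit the hyperplane. *)
  have := oxv ((offset j - dot (normal j) x) / dot (normal j) v).
  rewrite dotD dotZ divfK ?gt_eqF// => H.
  by have := H (divr_ge0 (ltW _) (ltW vj)); rewrite subr_gt0 => /(_ xj); lra.
- move=> xj oxv; rewrite leNgt; apply/negP => vj.
  have := oxv ((offset j - dot (normal j) x) / dot (normal j) v).
  rewrite dotD dotZ divfK ?lt_eqF// => H.
  have : 0 <= (offset j - dot (normal j) x) / dot (normal j) v.
    by rewrite ler_ndivlMr// mul0r subr_le0 ltW.
  by move=> /H; lra.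
Qed.

(** A small move along [v] stays in the cell, which lies in the hyperplane. *)
Lemma only_touches_dirspace D s j v : satisfiable D s ->
  (forall o', touches D s j o' -> o' = None) ->
  v \in dirspace (zeros D s) -> dot (normal j) v = 0.
Proof.
move=> /asboolP[x sx] only vz; have [e e0 se] := sat_open sx vz.
have := only_touches_open_side only sx; have := only_touches_open_side only se.
rewrite /= /hyperplane /= dotD dotZ => + xj; rewrite xj => h.
apply/eqP; have : e * dot (normal j) v == 0 by apply/eqP; lra.
by rewrite mulf_eq0 gt_eqF.
Qed.

Lemma touches_all_dirspace D s j : (forall o, touches D s j o) ->
  exists2 v, v \in dirspace (zeros D s) & dot (normal j) v != 0.
Proof.
move=> h; have [x [sx xj]] := h None; have [y [sy yj]] := h (Some true).
exists (y - x); first exact: sat_sub_dirspace sx sy.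
by move: xj yj; rewrite /= /hyperplane /= dotB => -> yj; rewrite subr_eq0 gt_eqF.
Qed.

(** Summing over the nonempty pieces only covers both outcomes of [hyperplane_splitP]. *)
Definition split_additive (phi : {set I} -> {ffun I -> option bool} -> int) : Prop :=
  forall D s j, j \notin D -> satisfiable D s ->
  \sum_(o | satisfiable (j |: D) (upd s j o)) phi (j |: D) (upd s j o) =
  phi D s.

Lemma additiveI (phi : {set I} -> {ffun I -> option bool} -> int) :
  (forall D s j, j \notin D -> satisfiable D s -> (forall o, touches D s j o) ->
     phi (j |: D) (upd s j None) + phi (j |: D) (upd s j (Some true)) +
     phi (j |: D) (upd s j (Some false)) = phi D s) ->
  (forall D s j o, j \notin D -> satisfiable D s ->
     (forall o', touches D s j o' -> o' = o) ->
     phi (j |: D) (upd s j o) = phi D s) ->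
  split_additive phi.
Proof.
move=> h3 h1 D s j jD sD; case: (hyperplane_splitP j sD) => [all|o ho only].
  rewrite (eq_bigl xpredT) ?sum_option_bool ?h3// => o.
  by apply/satisfiableU1.
rewrite (big_pred1 o) ?h1// => o' /=; apply/idP/eqP => [|->].
  by move/(satisfiableU1 _ _ jD)/only.
exact/satisfiableU1.
Qed.

Definition euler_sign D s : int := (-1) ^+ \dim (dirspace (zeros D s)).

(** If a cell of dimension [d] is cut, its middle piece has dimension [d - 1] and cancels one of the
    two open pieces. If it is not cut, its dimension does not change. *)
Lemma euler_sign_additive : split_additive euler_sign.
Proof.
apply: additiveI => D s j.
  move=> jD sD all; rewrite /euler_sign !zerosU1//=.
  have [v vz hv] := touches_all_dirspace all.
  by rewrite (dim_dirspaceU1 vz hv) exprS mulN1r subrr add0r.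
move=> o jD sD only; rewrite /euler_sign !zerosU1//=.
case: eqP => // o0; rewrite dirspaceU1_id// => v.
by apply: only_touches_dirspace sD _; rewrite -o0.
Qed.

(* Modulo its lineality space [dirspace D] a cell is either bounded, and then
   contributes its Euler sign, or unbounded, and then contributes 0. *)
Definition bounded_sign D s : int :=
  if `[< forall v, recession D s v -> v \in dirspace D >]
  then (-1) ^+ (\dim (dirspace (zeros D s)) + \dim (dirspace D))%N else 0.

Lemma bounded_sign_additive : split_additive bounded_sign.
Proof.
apply: additiveI => D s j; last first.
  move=> o jD sD only; rewrite /bounded_sign zerosU1//.
  (* Both [v] and [- v] are recession directions, so both lie on the closed side [o]. *)
  have hD v : v \in dirspace D -> dot (normal j) v = 0.
    move=> vD.
    have := only_touches_closed_side0 only sD (dirspace_recession s vD).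
    have vND : - v \in dirspace D by rewrite memvN.
    have := only_touches_closed_side0 only sD (dirspace_recession s vND).
    by rewrite -scaleN1r; case: (o) => [[]|]; rewrite /= dotZ => *; lra.
  rewrite dirspaceU1_id//.
  have -> : dirspace (if o == None then j |: zeros D s else zeros D s) =
            dirspace (zeros D s).
    case: eqP => // o0; rewrite dirspaceU1_id// => v.
    by apply: only_touches_dirspace sD _; rewrite -o0.
  congr (if _ then _ else _); apply/asboolP/asboolP => h v rv.
    by apply: h; apply/recessionU1 => //; split=> //;
      exact: only_touches_closed_side0 sD rv.
  by apply: h; case/(recessionU1 _ _ _ jD): rv.
move=> jD sD all.
(* [lin o] says that the piece on side [o] is bounded modulo its lineality space. *)
pose lin o := forall v, recession D s v -> closed_side0 j o v ->
  v \in dirspace (j |: D).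
pose linD := forall v, recession D s v -> v \in dirspace D.
pose z : nat := \dim (dirspace (zeros D s)).
have [v0 v0z hv0] := touches_all_dirspace all.
have linE o : bounded_sign (j |: D) (upd s j o) =
    if `[< lin o >] then
      (-1) ^+ ((if o == None then z.-1 else z) + \dim (dirspace (j |: D)))%N
    else 0.
  rewrite /bounded_sign zerosU1//.
  have -> : \dim (dirspace (if o == None then j |: zeros D s else zeros D s)) =
      if o == None then z.-1 else z.
    by case: ifP => // _; rewrite /z (dim_dirspaceU1 v0z hv0).
  congr (if _ then _ else _); apply/asboolP/asboolP => h v.
    by move=> rv cv; apply: h; apply/recessionU1.
  by move=> /(recessionU1 _ _ _ jD)[]; exact: h.
(* The cut makes the direction space of the cell nonzero, so [z.-1] is a true predecessor. *)
have zE : z = z.-1.+1 by rewrite /z (dim_dirspaceU1 v0z hv0).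
have memU1 v : v \in dirspace D -> dot (normal j) v = 0 -> v \in dirspace (j |: D).
  by move=> vD vj; rewrite dirspaceU1 memv_cap vD memv_ker lfunE /= vj.
have memU1E v : v \in dirspace (j |: D) -> v \in dirspace D /\ dot (normal j) v = 0.
  rewrite dirspaceU1 memv_cap memv_ker lfunE => /andP[vD /eqP]; by split.
rewrite !linE /= /bounded_sign -/z -/linD.
have lin0 b : lin (Some b) -> lin None.
  by move=> h v rv /= vj; apply: h => //=; case: b; rewrite vj.
have [hD|hD] := pselect linD.
  rewrite (asboolT hD).
  have L0 : lin None by move=> v /hD vD /= vj; exact: memU1.
  rewrite (asboolT L0).
  (* If the hyperplane is parallel to the lineality space, all three pieces are bounded modulo it
     and the Euler signs add up as before. *)
  have [h0|] := pselect (forall v, v \in dirspace D -> dot (normal j) v = 0).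
    have L b : lin (Some b) by move=> v /hD vD _; apply: memU1 => //; exact: h0.
    by rewrite !(asboolT (L _)) dirspaceU1_id// zE /= addSn exprS mulN1r subrr add0r.
  (* Otherwise the lineality space is cut: each open piece recedes along [u] or [- u], and only the
     middle one contributes, with both dimensions in the exponent lowered by one. *)
  move=> /existsNP[u /not_implyP[uD /eqP uj]].
  have L b : ~ lin (Some b).
    move=> h.
    have cu : closed_side0 j (Some b) u \/ closed_side0 j (Some b) (- u).
      rewrite -scaleN1r /= dotZ; clear zE; case: b {h} => /=;
        have [] := lerP 0 (dot (normal j) u) => ?; [left|right|right|left]; lra.
    have uND : - u \in dirspace D by rewrite memvN.
    case: cu => cu.
      by have /memU1E[_] := h _ (dirspace_recession s uD) cu; exact/eqP.
    have /memU1E[_ /eqP] := h _ (dirspace_recession s uND) cu.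
    by rewrite -scaleN1r dotZ mulN1r oppr_eq0 (negPf uj).
  rewrite !(asboolF (L _)) !addr0.
  by rewrite (dim_dirspaceU1 uD uj) zE /= addSn addnS !exprS !mulN1r opprK.
rewrite (asboolF hD).
(* The cell is now unbounded modulo lineality and the sum must be 0: at most one open piece
   contributes, and if one does, the middle piece cancels it. *)
have nboth : ~ (lin (Some true) /\ lin (Some false)).
  move=> [h1 h2]; apply: hD => v rv.
  have [hv|hv] := lerP 0 (dot (normal j) v).
    by have /memU1E[] := h1 v rv hv.
  by have /memU1E[] := h2 v rv (ltW hv).
have [h1|h1] := pselect (lin (Some true)).
  have h2 : ~ lin (Some false) by move=> h2; apply: nboth.
  by rewrite (asboolT (lin0 _ h1)) (asboolT h1) (asboolF h2) addr0
    [in X in _ + X]zE addSn exprS mulN1r subrr.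
have [h2|h2] := pselect (lin (Some false)).
  by rewrite (asboolT (lin0 _ h2)) (asboolF h1) (asboolT h2) addr0
    [in X in _ + X]zE addSn exprS mulN1r subrr.
(* If neither open piece contributes, neither does the middle one: each side has a recession
   direction strictly off the hyperplane. *)
have h0 : ~ lin None.
  move=> h0; clear zE.
  have pos b : ~ lin (Some b) -> exists2 u, recession D s u &
      if b then 0 < dot (normal j) u else dot (normal j) u < 0.
    move=> /existsNP[u /not_implyP[ru /not_implyP[cu nu]]]; exists u => //.
    have uj : dot (normal j) u != 0.
      by apply/eqP => uj; apply: nu; exact: h0.
    by case: b cu => /=; rewrite lt_neqAle ?uj// eq_sym uj.
  have [u ru /= uj] := pos true h1; have [u' ru' /= uj'] := pos false h2.
  (* A positive combination of [v] and [w] lies in the hyperplane, hence in the lineality space; as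
     both lie in the recession cone, each of them must then be a lineality direction. *)
  have key v w : recession D s v -> recession D s w ->
      dot (normal j) v * dot (normal j) w < 0 -> v \in dirspace D.
    move=> rv rw vw.
    pose a := `|dot (normal j) w|; pose b := `|dot (normal j) v|.
    have a0 : 0 < a.
      by rewrite normr_gt0; apply: contraTneq vw => ->; rewrite mulr0 ltxx.
    have b0 : 0 < b.
      by rewrite normr_gt0; apply: contraTneq vw => ->; rewrite mul0r ltxx.
    have abE : a * dot (normal j) v + b * dot (normal j) w = 0.
      rewrite /a /b; have [vj|vj] := ger0P (dot (normal j) v);
        have [wj|wj] := ger0P (dot (normal j) w); [exfalso; nra|ring|ring|exfalso; nra].
    have ra := recessionZ (ltW a0) rv; have rb := recessionZ (ltW b0) rw.
    have := h0 _ (recessionD ra rb); rewrite /= dotD !dotZ => /(_ abE).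
    move=> /memU1E[/dirspaceP e _]; apply/dirspaceP => i iD.
    have := e i iD; rewrite dotD !dotZ => {}e.
    move: (rv i iD) (rw i iD); rewrite /closed_side0.
    by case: (s i) => [[]|] //= *; nra.
  apply: hD => v rv; have [vj|vj|vj] := ltgtP (dot (normal j) v) 0.
  - by apply: (key v u rv ru); rewrite nmulr_rlt0.
  - by apply: (key v u' rv ru'); rewrite pmulr_rlt0.
  - by have /memU1E[] := h0 v rv vj.
by rewrite (asboolF h1) (asboolF h2) (asboolF h0) !addr0.
Qed.

End Valuations.

(** * Faces *)

Section Faces.
Variables (R : realType) (n : nat) (A : arrangement R n).
Local Notation I := 'I_(nhyp A).
Local Notation IT := [set: I]%SET.
Implicit Types (B D : {set I}) (s t : {ffun I -> option bool}) (i j : I)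
  (o : option bool) (x y p v w : 'rV[R]_n) (F G : face A).

Definition signs F : {ffun I -> option bool} := projT1 (cid (faceP F).1).

Lemma cell_signs F : cell (signs F) = fsval F.
Proof. by rewrite /signs; case: cid => s /= ->. Qed.

Lemma cell_sat s x : cell s x <-> sat IT s x.
Proof. by split=> h i _; apply: h; rewrite ?inE. Qed.

Lemma face_sat F x : fsval F x <-> sat IT (signs F) x.
Proof. by rewrite -cell_signs; exact: cell_sat. Qed.

Lemma open_side_inj i o o' x : open_side i o x -> open_side i o' x -> o = o'.
Proof.
by case: o => [[]|]; case: o' => [[]|] //=; rewrite /hyperplane /= => *;
  exfalso; lra.
Qed.

Lemma signs_eq F s x : sat IT s x -> fsval F x -> signs F = s.
Proof.
move=> sx /face_sat Fx; apply/ffunP => i.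
by apply: (@open_side_inj i _ _ x); [apply: Fx | apply: sx]; rewrite inE.
Qed.

Lemma face_point F : exists x, sat IT (signs F) x.
Proof. by have [_ [x /face_sat]] := faceP F; exists x. Qed.

Lemma cell_face s : satisfiable IT s -> exists F, signs F = s.
Proof.
move=> /asboolP[x sx]; have cx : cell s x by apply/cell_sat.
have Fs : cell s \in faces A.
  rewrite !inE; apply/andP; split; first by apply/set0P; exists x.
  by apply/imfsetP; exists s.
by exists [` Fs]%fset; apply: signs_eq sx _.
Qed.

Lemma signs_inj : injective signs.
Proof. by move=> F G e; apply/val_inj; rewrite /= -!cell_signs e. Qed.

Definition agree D s F : bool := [forall i in D, signs F i == s i].

Lemma agreeP D s F :
  reflect (forall i, i \in D -> signs F i = s i) (agree D s F).
Proof. by apply: (iffP forall_inP) => h i /h /eqP. Qed.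

Lemma agreeU1 D s j o F : j \notin D ->
  agree (j |: D) (upd s j o) F = agree D s F && (signs F j == o).
Proof.
move=> jD; apply/agreeP/andP => [h|[/agreeP h /eqP hj] i].
  split; last by rewrite h ?setU11// updE.
  apply/agreeP => i iD; rewrite h ?setU1r// upd_neq//.
  by apply: contraNneq jD => <-.
rewrite !inE => /orP[/eqP ->|iD]; rewrite ?updE// upd_neq; first exact: h.
by apply: contraNneq jD => <-.
Qed.

Lemma agree_satisfiable D s F : agree D s F -> satisfiable D s.
Proof.
move=> /agreeP h; have [x Fx] := face_point F.
by apply/asboolP; exists x => i iD; rewrite -h//; apply: Fx; rewrite inE.
Qed.

(** Induction on the number of hyperplanes outside [D]: adding one splits the cell and sorts its
    faces by their sign at [j]. When none is left, the cell is a single face. *)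
Lemma sum_faces (phi : {set I} -> {ffun I -> option bool} -> int) D s :
  split_additive phi -> satisfiable D s ->
  \sum_(F : face A | agree D s F) phi IT (signs F) = phi D s.
Proof.
move=> addphi; move: {2}#|~: D| (erefl #|~: D|) => m.
elim: m D s => [|m IHm] D s cD sD.
  have DT : D = IT.
    by apply/setP => i; move/eqP: cD; rewrite cards_eq0 => /eqP/setP/(_ i);
      rewrite !inE => /negbFE.
  rewrite DT in sD *; have [F Fs] := cell_face sD.
  rewrite (big_pred1 F) ?Fs// => G /=; apply/agreeP/eqP => [h|-> i _].
    by apply: signs_inj; rewrite Fs; apply/ffunP => i; apply: h; rewrite inE.
  by rewrite Fs.
have /card_gt0P[j] : (0 < #|~: D|)%N by rewrite cD.
rewrite inE => jD; rewrite -(addphi D s j jD sD).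
have cj : #|~: (j |: D)| = m.
  apply/eqP; rewrite -(eqn_add2l 1) !add1n -cD (cardsD1 j (~: D)) inE jD add1n.
  by apply/eqP; congr (_.+1); apply: fintype.eq_card => i; rewrite !inE negb_or.
rewrite (partition_big (fun F => signs F j)
  (fun o => satisfiable (j |: D) (upd s j o))) /=.
  apply: eq_bigr => o so; rewrite -IHm//.
  by apply: eq_bigl => F; rewrite agreeU1.
by move=> F FD; apply: (@agree_satisfiable _ _ F); rewrite agreeU1// FD eqxx.
Qed.

Local Open Scope classical_set_scope.

Lemma face_leE F G : (F <= G)%O = `[< fsval F `<=` closure (fsval G) >].
Proof. by []. Qed.

(** In a closure, signs can only degenerate to zero. Conversely, for [x] in [F] and [y] in [G], the
    points [x + e *: (y - x)] with [0 < e < 1] lie in [G] and tend to [x]. *)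
Lemma face_leP F G :
  reflect (forall i, signs F i != None -> signs G i = signs F i) (F <= G)%O.
Proof.
rewrite face_leE; apply: (iffP (asboolP _)) => [FG i sFi|h x /face_sat Fx].
  have [x Fx] := face_point F.
  have : closure (cell (signs G)) x.
    by rewrite cell_signs; apply/FG/face_sat.
  move=> /(@closure_cell _ _ _ _ i) cx; have ox := Fx i (finset.in_setT i).
  move: sFi cx ox; case: (signs F i) => [[]|] // _; case: (signs G i) => [[]|] //=;
    rewrite /hyperplane /= => *; exfalso; lra.
have [y Gy] := face_point G; move=> B Bx.
have cvgx : x + e *: (y - x) @[e --> (0 : R)^'+] --> x.
  suff : x + e *: (y - x) @[e --> (0 : R)^'+] --> x + 0 *: (y - x).
    by rewrite scale0r addr0.
  apply: cvgD; first exact: cvg_cst.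
  apply: cvgZr_tmp.
  by apply: cvg_at_right_filter; exact: cvg_id.
have : \forall e \near (0 : R)^'+, fsval G (x + e *: (y - x)) /\
    B (x + e *: (y - x)).
  near=> e; split; last by near: e; exact: cvgx.
  have e0 : 0 < e by near: e; exact: nbhs_right_gt.
  have e1 : e < 1 by near: e; exact: nbhs_right_lt.
  apply/face_sat => i _; move: (Fx i (finset.in_setT i)) (Gy i (finset.in_setT i)) (h i).
  case: (signs F i) => [b|] /=.
    move=> xi yi /(_ isT) Gi; move: yi xi; rewrite Gi.
    by clear -e0 e1; case: b => /=; rewrite dotD dotZ dotB => *; nra.
  rewrite /hyperplane /= => xi + _; clear -e0 e1 xi.
  by case: (signs G i) => [[]|] /=; rewrite /hyperplane /= dotD dotZ dotB => *; nra.
by move=> /filter_ex[e]; exists (x + e *: (y - x)).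
Unshelve. all: by end_near. Qed.

(** A nonzero recession direction gives an unbounded ray. Conversely, a homogeneous measure [g] of
    violation is bounded along the face and, by compactness, bounded below by a positive constant on
    the unit sphere. *)
Lemma signs_bounded F :
  bounded_set (fsval F) <-> (forall v, recession IT (signs F) v -> v = 0).
Proof.
split=> [[M [Mr bM]] v rv|rec0].
  apply/eqP; apply: contrapT => /negP v0.
  have [x Fx] := face_point F.
  pose M' := `|M| + 1.
  have MM' : M < M' by rewrite (le_lt_trans (ler_norm M))// ltrDl.
  pose a := (M' + `|x| + 1) / `|v|.
  have nv : 0 < `|v| by rewrite normr_gt0.
  have a0 : 0 <= a by rewrite divr_ge0 ?addr_ge0 ?normr_ge0// .
  have /face_sat Fxv := sat_recession Fx (recessionZ a0 rv).
  have := bM M' MM' _ Fxv; rewrite /= leNgt => /negP; apply.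
  have : `|a *: v| <= `|x + a *: v| + `|x|.
    by rewrite -{1}[a *: v](addrK x) [a *: v + x]addrC ler_normB.
  rewrite normrZ ger0_norm// /a divfK ?gt_eqF// => h; lra.
have [x0 Fx0] := face_point F.
pose c i : R := if signs F i is Some b then (if b then 1 else -1) else 0.
(* [viol i v] is nonnegative and vanishes only if [v] satisfies the weak condition at [i]; so [g]
   vanishes only at 0. *)
pose viol i v : R := `|dot (normal i) v| - c i * dot (normal i) v.
pose g v := \sum_i viol i v.
have viol_ge0 i v : 0 <= viol i v.
  rewrite /viol /c; case: (signs F i) => [[]|];
    have [] := ger0P (dot (normal i) v) => *; lra.
have viol_eq0 i v : viol i v = 0 -> closed_side0 i (signs F i) v.
  rewrite /viol /c; case: (signs F i) => [[]|] /=;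
    have [] := ger0P (dot (normal i) v) => *; lra.
have g0 v : g v = 0 -> v = 0.
  move=> gv; apply: rec0 => i _; apply: viol_eq0.
  by move/eqP: gv; rewrite psumr_eq0// => /allP/(_ i (mem_index_enum i))/eqP.
have gZ (a : R) v : 0 <= a -> g (a *: v) = a * g v.
  move=> a0; rewrite /g mulr_sumr; apply: eq_bigr => i _.
  by rewrite /viol dotZ normrM (ger0_norm a0); ring.
(* Points of the face stay on the side of [x0], so a move in the wrong direction is at most the gap
   between [x0] and the hyperplane, and [viol] counts it twice. *)
pose K : R := \sum_(i : I) 2 * `|dot (normal i) x0 - offset i|.
have gK x : fsval F x -> g (x - x0) <= K.
  move=> /face_sat Fx; apply: ler_sum => i _.
  move: (Fx i (finset.in_setT i)) (Fx0 i (finset.in_setT i)); rewrite /viol /c dotB.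
  have [] := ger0P (dot (normal i) x - dot (normal i) x0);
  have [] := ger0P (dot (normal i) x0 - offset i);
  by case: (signs F i) => [[]|]; rewrite /= /hyperplane /= => *; lra.
pose S := [set v : 'rV[R]_n | `|v| = 1].
(* The unit sphere is empty in dimension 0, where every point is 0. *)
have [S0|S0] := pselect (S !=set0); last first.
  exists 0; split; first exact: real0.
  move=> M M0 x _ /=; have [->|x0'] := eqVneq x 0; first by rewrite normr0 ltW.
  case: S0; exists (`|x|^-1 *: x); rewrite /S /= normrZ normfV normr_id.
  by rewrite mulVf// normr_eq0.
have cS : compact S.
  apply: bounded_closed_compact.
    by exists 1; split; [exact: real1|move=> M M1 v /= ->; exact: ltW].
  apply: (@preimage_closed _ _ (fun v : 'rV[R]_n => `|v|) [set y | y = 1]).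
    by move=> v _; exact: norm_continuous.
  exact: closed_eq.
have cg : continuous g.
  apply: continuous_big => [|i _]; first exact: add_continuous.
  move=> v; apply: (@continuousB R R 'rV[R]_n (fun v => `|dot (normal i) v|)
    (fun v => c i * dot (normal i) v)).
    by apply: (@continuous_comp _ _ _ (dot (normal i)) Num.norm);
      [exact: dot_continuous|exact: norm_continuous].
  by apply: (@continuousM R 'rV[R]_n (fun=> c i) (dot (normal i)));
    [exact: cst_continuous|exact: dot_continuous].
have [u Su gmin] := @EVT_min_rV R n g S S0 cS (continuous_subspaceT cg).
have gu : 0 < g u.
  rewrite lt_neqAle sumr_ge0// andbT eq_sym; apply/eqP => /g0 u0.
  by move: Su; rewrite inE /S /= u0 normr0 => /esym/eqP; rewrite oner_eq0.
have K0 : 0 <= K by apply: sumr_ge0 => i _; rewrite mulr_ge0.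
exists (`|x0| + K / g u); split; first exact: num_real.
move=> M MM x Fx /=; apply: le_trans (ltW MM).
rewrite -[x in `|x|](subrK x0) addrC; apply: le_trans (ler_normD _ _) _.
rewrite lerD2l ler_pdivlMr//; have [->|r0] := eqVneq (x - x0) 0.
  by rewrite normr0 mul0r.
have rp : 0 < `|x - x0| by rewrite normr_gt0.
apply: le_trans (gK x Fx).
have -> : x - x0 = `|x - x0| *: (`|x - x0|^-1 *: (x - x0)).
  by rewrite scalerA divff ?scale1r// gt_eqF.
rewrite gZ// normrZ normr_id normrZ normfV normr_id mulVf ?gt_eqF// mulr1.
rewrite ler_pM2l//; apply: gmin; rewrite inE /S /= normrZ normfV normr_id.
by rewrite mulVf// gt_eqF.
Qed.

End Faces.

(** * Alternating sums over faces *)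

Section Lattice.
Variables (R : realType) (n : nat) (A : arrangement R n).
Local Notation I := 'I_(nhyp A).
Local Notation IT := [set: I]%SET.
Implicit Types (B D : {set I}) (s t : {ffun I -> option bool}) (i j : I)
  (o : option bool) (p v w : 'rV[R]_n) (F G : face A) (X Y W : int_lattice A).

Lemma flat_dirspace B p q : flat B p -> flat B q <-> q - p \in dirspace B.
Proof.
move=> Bp; split=> [Bq|/dirspaceP h i /= iB].
  apply/dirspaceP => i iB; move: (Bp i iB) (Bq i iB).
  by rewrite /hyperplane /= dotB => -> ->; rewrite subrr.
by move: (Bp i iB) (h i iB); rewrite /hyperplane /= dotB => -> /subr0_eq.
Qed.

(** The space chosen by [xget] consists of the differences of points of the flat, which determines
    it. *)
Lemma affine_dim_flat B p : flat B p -> affine_dim (flat B) = \dim (dirspace B).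
Proof.
move=> Bp; rewrite /affine_dim.
set S := [set V | _]%classic.
have [q fE] : S (xget 0%VS S).
  apply: xgetPex; exists (dirspace B), p; apply/seteqP.
  by split=> q /(flat_dirspace _ Bp).
congr (\dim _); apply/vspaceP => v.
have Bq : flat B q by rewrite fE /= subrr mem0v.
have -> : (v \in dirspace B) = `[< flat B (q + v) >].
  apply/idP/asboolP => [vB|/(flat_dirspace _ Bq)]; last by rewrite addrC addKr.
  by apply/(flat_dirspace _ Bq); rewrite addrC addKr.
rewrite fE /=; apply/idP/asboolP => /=; by rewrite addrC addKr.
Qed.

Lemma int_latticeP X : X != empty_flat A ->
  exists B, fsval X = flat B /\ exists p, flat B p.
Proof.
move=> X0; have := fsvalP X; rewrite !inE => /orP[/eqP e|/imfsetP[B _ XB]].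
  by case/eqP: X0; apply: val_inj.
exists B; split=> //; apply: contrapT => h; case/eqP: X0; apply: val_inj => /=.
by rewrite XB; apply/seteqP; split=> // p Bp; case: h; exists p.
Qed.

Lemma int_lattice_leE X Y : (X <= Y)%O = `[< (fsval Y `<=` fsval X)%classic >].
Proof. by []. Qed.

Lemma le_empty_flat X : (X <= empty_flat A)%O.
Proof. by rewrite int_lattice_leE; apply/asboolP. Qed.

Definition flat_dim X : nat := affine_dim (fsval X).

Lemma flat_dim_le X : X != empty_flat A -> (flat_dim X <= n)%N.
Proof.
move=> /int_latticeP[B [XB [p Bp]]]; rewrite /flat_dim XB (affine_dim_flat Bp).
by have := dimvS (subvf (dirspace B)); rewrite dimvf /dim /= mul1n.
Qed.

Lemma flat_dim_anti X Y : (X <= Y)%O -> Y != empty_flat A ->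
  (flat_dim Y <= flat_dim X)%N.
Proof.
rewrite int_lattice_leE => /asboolP YX Y0.
have [C [YC [p Cp]]] := int_latticeP Y0.
have X0 : X != empty_flat A.
  apply/eqP => X0; have : fsval X p by apply: YX; rewrite YC.
  by rewrite X0.
have [B [XB _]] := int_latticeP X0; rewrite XB YC in YX.
rewrite /flat_dim XB YC (affine_dim_flat Cp) (affine_dim_flat (YX _ Cp)).
apply/dimvS/subvP => v vC.
have : flat B (p + v).
  by apply: YX; apply/(flat_dirspace _ Cp); rewrite addrC addKr.
by move/(flat_dirspace _ (YX _ Cp)); rewrite addrC addKr.
Qed.

(** Below the maximum, a rank difference is a drop in dimension, and only its parity matters for the
    sign. *)
Lemma int_rank_sign X W : (X <= W)%O -> W != empty_flat A ->
  (-1) ^+ (int_rank W - int_rank X)%N = (-1) ^+ flat_dim X * (-1) ^+ flat_dim W :> int.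
Proof.
move=> XW W0.
have X0 : X != empty_flat A.
  by apply: contraNneq W0 => X0; rewrite eq_le le_empty_flat -X0.
have dX := flat_dim_le X0; have dXW := flat_dim_anti XW W0.
rewrite /int_rank (negPf X0) (negPf W0) -/(flat_dim X) -/(flat_dim W).
have -> : (n - flat_dim W - (n - flat_dim X) = flat_dim X - flat_dim W)%N by lia.
rewrite -[in RHS](subnK dXW) exprD -mulrA -exprD addnn.
by rewrite -[in RHS](@signr_odd _ _.*2) odd_double mulr1.
Qed.

Lemma face_hullE F : fsval (face_hull F) = flat (zeros IT (signs F)).
Proof.
have [x Fx] := face_point F.
rewrite /= -cell_signs affine_hull_cell; last by exists x; apply/cell_sat.
by congr flat; apply/setP => i; rewrite !inE.
Qed.

Lemma face_hull_point F p : sat IT (signs F) p -> flat (zeros IT (signs F)) p.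
Proof.
by move=> Fp i /=; rewrite inE => /andP[iT /eqP si]; have := Fp i iT; rewrite si.
Qed.

Lemma face_hull_neq0 F : face_hull F != empty_flat A.
Proof.
have [x Fx] := face_point F; apply/eqP => e.
have := face_hull_point Fx; rewrite -face_hullE e.
by [].
Qed.

Lemma euler_sign_face F :
  euler_sign IT (signs F) = (-1) ^+ flat_dim (face_hull F).
Proof.
have [x Fx] := face_point F.
by rewrite /euler_sign /flat_dim face_hullE (affine_dim_flat (face_hull_point Fx)).
Qed.

Lemma le_face_hull X B F : fsval X = flat B ->
  (X <= face_hull F)%O = [forall i in B, signs F i == None].
Proof.
move=> XB; rewrite int_lattice_leE face_hullE XB.
apply/asboolP/forall_inP => [h i iB|h p Fp i /= iB].
  have [x Fx] := face_point F; have := h x (face_hull_point Fx) i iB => xi.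
  by apply/eqP; apply: (@open_side_inj _ _ _ i _ _ x) => //; apply: Fx; rewrite inE.
by apply: Fp; rewrite /= !inE; exact: h.
Qed.

(** The flat itself is the cell given by the equations in [B] alone. *)
Lemma sum_euler_flat X : X != empty_flat A ->
  \sum_(F : face A | (X <= face_hull F)%O) (-1) ^+ flat_dim (face_hull F) =
  (-1) ^+ flat_dim X :> int.
Proof.
move=> /int_latticeP[B [XB [p Bp]]].
pose s : {ffun I -> option bool} := [ffun=> None].
have sB : satisfiable B s.
  by apply/asboolP; exists p => i iB; rewrite ffunE; exact: Bp.
have zB : zeros B s = B by apply/setP => i; rewrite !inE ffunE eqxx andbT.
have := sum_faces (@euler_sign_additive R n A) sB.
rewrite {2}/euler_sign zB /flat_dim XB (affine_dim_flat Bp) => <-.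
apply: eq_big => [F|F _]; last by rewrite euler_sign_face.
by rewrite (le_face_hull _ XB); apply: eq_forallb => i; rewrite ffunE.
Qed.

Lemma sum_euler_star X G : (X <= face_hull G)%O ->
  \sum_(F : face A | (X <= face_hull F)%O && (G <= F)%O)
     (-1) ^+ flat_dim (face_hull F) =
  (-1) ^+ flat_dim X :> int.
Proof.
move=> XG; have X0 : X != empty_flat A.
  apply: contraNneq (face_hull_neq0 G) => X0.
  by rewrite eq_le le_empty_flat -X0.
have [B [XB [p Bp]]] := int_latticeP X0.
move: (XG); rewrite (le_face_hull _ XB) => /forall_inP GB.
(* The equations of [X] together with the nonzero signs of [G] cut out a cell in [X] whose faces are
   those with [G] in their closure. *)
pose D := (B :|: [set i | signs G i != None])%SET.
have sD : satisfiable D (signs G).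
  have [x Gx] := face_point G.
  by apply/asboolP; exists x => i _; apply: Gx; rewrite inE.
have zD : zeros D (signs G) = B.
  apply/setP => i; rewrite !inE; case: (boolP (i \in B)) => iB /=.
    exact: GB.
  by case: (signs G i).
have := sum_faces (@euler_sign_additive R n A) sD.
rewrite {2}/euler_sign zD /flat_dim XB (affine_dim_flat Bp) => <-.
apply: eq_big => [F|F _]; last by rewrite euler_sign_face.
rewrite (le_face_hull _ XB); apply/andP/agreeP => [[/forall_inP FB /face_leP FG] i|h].
  rewrite !inE => /orP[iB|]; last exact: FG.
  by rewrite (eqP (FB _ iB)) (eqP (GB _ iB)).
split; last by apply/face_leP => i si; apply: h; rewrite !inE si orbT.
by apply/forall_inP => i iB; rewrite h ?inE ?iB//; exact: GB.
Qed.

Lemma dotC (u v : 'rV[R]_n) : dot u v = dot v u.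
Proof. by apply: eq_bigr => j _; rewrite mulrC. Qed.

Lemma dot_self_eq0 (v : 'rV[R]_n) : dot v v = 0 -> v = 0.
Proof.
move=> /eqP; rewrite psumr_eq0 => [/allP h|j _]; last by rewrite -expr2 sqr_ge0.
apply/rowP => j; have /eqP := h j (mem_index_enum j).
by rewrite mxE => /eqP; rewrite mulf_eq0 orbb => /eqP.
Qed.

(** A vector orthogonal to all normals is orthogonal to their span, hence to itself. *)
Lemma essential_dirspace : essential A -> dirspace IT = 0%VS.
Proof.
move=> ess; apply/eqP; rewrite -subv0; apply/subvP => v /dirspaceP h.
rewrite memv0; apply/eqP/dot_self_eq0.
have : v \in <<[seq normal i | i : I]>>%VS by rewrite ess memvf.
have /span_subvP H : {subset [seq normal i | i : I] <=
    lker (linfun (dot v : 'rV[R]_n -> R^o))}.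
  move=> _ /codomP[i ->]; rewrite memv_ker lfunE /= dotC; apply/eqP/h.
  by rewrite inE.
by move=> /(subvP H); rewrite memv_ker lfunE => /eqP.
Qed.

Definition face_bounded F : bool := `[< bounded_set (fsval F) >].

(** A flat is its own lineality space, so its [bounded_sign] has an even exponent. Essentiality
    makes the lineality of faces trivial, so there [bounded_sign] is the Euler sign on bounded faces
    and 0 elsewhere. *)
Lemma sum_bounded_flat X : essential A -> X != empty_flat A ->
  \sum_(F : face A | (X <= face_hull F)%O && face_bounded F)
     (-1) ^+ flat_dim (face_hull F) = 1 :> int.
Proof.
move=> ess /int_latticeP[B [XB [p Bp]]].
pose s : {ffun I -> option bool} := [ffun=> None].
have sB : satisfiable B s.
  by apply/asboolP; exists p => i iB; rewrite ffunE; exact: Bp.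
have zB : zeros B s = B by apply/setP => i; rewrite !inE ffunE eqxx andbT.
have := sum_faces (@bounded_sign_additive R n A) sB.
rewrite {2}/bounded_sign zB asboolT; last first.
  by move=> v rv; apply/dirspaceP => i iB; have := rv i iB; rewrite ffunE.
rewrite addnn -signr_odd odd_double expr0 => sE; apply: etrans sE.
rewrite big_mkcondr /=; apply: eq_big => [F|F _].
  by rewrite (le_face_hull _ XB); apply: eq_forallb => i; rewrite ffunE.
rewrite /bounded_sign essential_dirspace// dimv0 addn0 -euler_sign_face.
congr (if _ then _ else _); apply/asboolP/asboolP.
  by move=> /signs_bounded h v /h ->; rewrite mem0v.
by move=> h; apply/signs_bounded => v /h; rewrite memv0 => /eqP.
Qed.

(** Passing to a face of the closure only strengthens weak inequalities to equations, so the
    recession cone shrinks. *)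
Lemma face_bounded_le F G : (F <= G)%O -> face_bounded G -> face_bounded F.
Proof.
move=> /face_leP FG /asboolP/signs_bounded h.
apply/asboolP/signs_bounded => v rv; apply: h => i iT.
have := rv i iT; case: (eqVneq (signs F i) None) => [->|/FG -> //] /=.
by rewrite /closed_side0; case: (signs G i) => [[]|] ->.
Qed.

Lemma face_hull_anti F G : (F <= G)%O -> (face_hull G <= face_hull F)%O.
Proof.
move=> /face_leP FG; rewrite (le_face_hull _ (face_hullE G)).
apply/forall_inP => i; rewrite !inE /=; apply: contraTT => si.
by rewrite FG.
Qed.

End Lattice.

(** * Zaslavsky's counts *)

Section Counting.
Variables (R : realType) (n : nat) (A : arrangement R n).
Implicit Types (F G : face A) (X Y W : int_lattice A).

(** All faces with hull [X] carry the same sign, so inverting the signed sums and multiplying by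
    that sign gives their number. *)
Lemma mobius_inversion_faces (q : pred (face A)) (f : int_lattice0 A -> int) X Y :
  (X <= Y)%O -> (forall F, q F -> (face_hull F <= Y)%O) ->
  (forall Z, (X <= Z <= Y)%O ->
     \sum_(F | q F && (Z <= face_hull F)%O) (-1) ^+ flat_dim (face_hull F) =
     f (BElt Z)) ->
  #|[pred F | q F && (face_hull F == X)]|%:Z =
  (-1) ^+ flat_dim X *
  \sum_(z : int_lattice0 A | (BElt X <= z <= BElt Y)%O)
     mobius (BElt X : int_lattice0 A) z * f z.
Proof.
move=> XY qY fE.
pose g (w : int_lattice0 A) : int :=
  \sum_(F | q F && (BElt (face_hull F) == w)) (-1) ^+ flat_dim (face_hull F).
rewrite -(@mobius_inversion _ _ f g); first last.
- case=> [|Z] // ZI; rewrite -fE//.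
  rewrite (partition_big (fun F => BElt (face_hull F) : int_lattice0 A)
    (fun w => (BElt Z <= w <= BElt Y)%O)) /=; last first.
    by move=> F /andP[qF ZF]; apply/andP; split; [exact: ZF|exact: qY].
  apply: eq_bigr => w /andP[Zw _]; apply: eq_bigl => F.
  case: (eqVneq _ w) => [wE|]; rewrite ?andbF// !andbT.
  by rewrite -wE in Zw; rewrite (Zw : (Z <= face_hull F)%O) andbT.
- exact: XY.
rewrite /g (eq_bigr (fun=> (-1) ^+ flat_dim X)) => [|F /andP[_ /eqP[->]]//].
rewrite (eq_bigl (mem [pred F | q F && (face_hull F == X)])) => [|F]; last first.
  by rewrite inE; congr (_ && _); apply/eqP/eqP => [[]|->].
rewrite sumr_const -mulr_natr natz mulrA -exprD addnn -signr_odd odd_double.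
by rewrite mul1r.
Qed.

Lemma card_star_faces X G : (X <= face_hull G)%O ->
  #|[pred F | (G <= F)%O && (face_hull F == X)]|%:Z =
  Zint (@int_rank0 R n A) (BElt X) (BElt (face_hull G)).
Proof.
move=> XG.
rewrite (@mobius_inversion_faces (fun F => (G <= F)%O)
  (fun z => if z is BElt Z then (-1) ^+ flat_dim Z else 0) X (face_hull G))//.
- rewrite /Zint mulr_sumr; apply: eq_bigr => -[|W]; first by [].
  move=> /andP[XW WG]; rewrite /= subSS int_rank_sign//.
    by rewrite mulrA mulrAC.
  apply: contraNneq (face_hull_neq0 G) => W0.
  by rewrite eq_le le_empty_flat -W0.
- by move=> F; exact: face_hull_anti.
- move=> Z /andP[_ ZG]; rewrite -(sum_euler_star ZG).
  by apply: eq_bigl => F; rewrite andbC.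
Qed.

Lemma card_unbounded_faces X : essential A -> X != empty_flat A ->
  #|[pred F | ~~ face_bounded F && (face_hull F == X)]|%:Z =
  Zint_ub (@int_rank0 R n A) (BElt X) (hat1 A).
Proof.
move=> ess X0; pose x : int_lattice0 A := BElt X.
have x1 : (x < hat1 A)%O.
  rewrite lt_neqAle; apply/andP; split; last exact: le_empty_flat.
  by apply: contraNneq X0 => -[->].
(* All faces minus bounded ones give [(-1) ^+ flat_dim Z - 1]; the empty flat contains no face. *)
rewrite (@mobius_inversion_faces (fun F => ~~ face_bounded F)
  (fun z => if z is BElt Z then
     if Z == empty_flat A then 0 else (-1) ^+ flat_dim Z - 1
   else 0) X (empty_flat A)).
- rewrite /Zint_ub /Zint /Zint_b -/x -/(hat1 A).
  have hx1 : (x <= hat1 A <= hat1 A)%O by rewrite lexx andbT ltW.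
  (* The constant [- 1] sums the Moebius function over all but the maximum, which yields
     [mobius x (hat1 A)]. *)
  have := mobius_sum x1; rewrite !(bigD1 (P := fun z => (x <= z <= hat1 A)%O) _ hx1) /=.
  rewrite eqxx mulr0 add0r => /eqP; rewrite addrC addr_eq0 => /eqP mE.
  (* The rank of the maximum exceeds that of [X] by one more than [flat_dim X]; this extra sign
     turns [Z] into [Z - 2 Z_b]. *)
  have s1 : (-1) ^+ ((int_rank (empty_flat A)).+1 - (int_rank X).+1)%N =
      - (-1) ^+ flat_dim X :> int.
    rewrite subSS /int_rank eqxx (negPf X0) -/(flat_dim X) subSn ?leq_subr//.
    by rewrite subKn ?flat_dim_le// exprS mulN1r.
  rewrite s1.
  have -> : \sum_(i | (x <= i <= hat1 A)%O && (i != hat1 A)) mobius x i *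
      match i with Bot => 0 | BElt Z =>
        if Z == empty_flat A then 0 else (-1) ^+ flat_dim Z - 1 end =
    \sum_(i | (x <= i <= hat1 A)%O && (i != hat1 A)) (-1) ^+ flat_dim X *
      ((-1) ^+ (int_rank0 i - (int_rank X).+1) * mobius x i) -
    \sum_(i | (x <= i <= hat1 A)%O && (i != hat1 A)) mobius x i.
    rewrite -sumrB; apply: eq_bigr => -[|W]; first by rewrite andFb.
    move=> /andP[/andP[XW _] W1].
    have W0 : W != empty_flat A by apply: contraNneq W1 => ->.
    rewrite (negPf W0) /= subSS int_rank_sign// !mulrA -exprD addnn.
    by rewrite -(@signr_odd _ _.*2) odd_double mul1r mulrBr mulr1 [mobius _ _ * _]mulrC.
  rewrite mE -mulr_sumr mulrBr mulrA -exprD addnn.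
  rewrite -(@signr_odd _ _.*2) odd_double mul1r.
  move: ((-1) ^+ flat_dim X) (mobius x (hat1 A)) (\sum_(i | _) _) => a b c; ring.
- exact: le_empty_flat.
- by move=> F _; exact: le_empty_flat.
move=> Z _; case: eqVneq => [->|Z0].
  rewrite big_pred0// => F; apply/negbTE; rewrite negb_and; apply/orP; right.
  apply: contra (face_hull_neq0 F) => h.
  by rewrite eq_le h le_empty_flat.
rewrite -(sum_euler_flat Z0) -[X in _ = _ - X](sum_bounded_flat ess Z0).
rewrite [in RHS](bigID (@face_bounded R n A)) /= addrC addrK.
by apply: eq_bigl => F; rewrite andbC.
Qed.

End Counting.

(** * The poset of unbounded faces *)

Section UnboundedPoset.
Variables (R : realType) (n : nat) (A : arrangement R n).
Implicit Types (F G : face A) (X Y W : int_lattice A) (y : Qposet A).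

Lemma BElt_inj (P : Type) : injective (@BElt P).
Proof. by move=> a b []. Qed.

Lemma min_or_unbounded_min :
  @min_or_unbounded R n A (BElt Top : face_lattice A).
Proof. by []. Qed.

Definition ub_min : unbounded_part A := UnboundedPart min_or_unbounded_min.

Definition Qmin : Qposet A := TElt ub_min.

(* Sends bounded faces to the junk value [Qmin]. *)
Definition Qface F : Qposet A :=
  TElt (insubd ub_min (BElt (TElt F) : (face_lattice A)^d)).

Lemma val_Qface F : ~~ face_bounded F ->
  ub_val (insubd ub_min (BElt (TElt F) : (face_lattice A)^d)) = BElt (TElt F).
Proof.
move=> Fu; apply: (@insubdK _ _ (unbounded_part A)).
by rewrite unfold_in /= asbool_neg.
Qed.

Lemma z_ub_Qface F : ~~ face_bounded F -> z_ub (Qface F) = BElt (face_hull F).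
Proof. by move=> Fu; rewrite /z_ub /Qface val_Qface. Qed.

Lemma Qface_inj :
  {in [pred F | ~~ face_bounded F] &, injective Qface}.
Proof.
move=> F G Fu Gu [] /(congr1 (@ub_val R n A)).
by rewrite !val_Qface// => -[].
Qed.

Lemma le_Qface F G : ~~ face_bounded F -> ~~ face_bounded G ->
  (Qface F <= Qface G)%O = (G <= F)%O.
Proof.
move=> Fu Gu.
have -> : (Qface F <= Qface G)%O =
  ((ub_val (insubd ub_min (BElt (TElt F) : (face_lattice A)^d)) : (face_lattice A)^d) <=
   ub_val (insubd ub_min (BElt (TElt G) : (face_lattice A)^d)))%O by [].
by rewrite !val_Qface.
Qed.

Lemma QposetP y :
  [\/ y = Top, y = Qmin | exists2 F, ~~ face_bounded F & y = Qface F].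
Proof.
case: y => [|[[|[|F]] // yP]]; [by constructor 1| |].
  by constructor 2; congr TElt; apply: val_inj.
have Fu : ~~ face_bounded F by rewrite /face_bounded -asbool_neg.
by constructor 3; exists F => //; congr TElt; apply: val_inj; rewrite /= val_Qface.
Qed.

Lemma z_ub_hat1 y : (z_ub y == hat1 A) = (y == Top).
Proof.
apply/eqP/eqP => [|-> //]; have [->//|->//|[F Fu ->]] := QposetP y.
by rewrite z_ub_Qface// => e; case/eqP: (face_hull_neq0 F); exact: (BElt_inj e).
Qed.

Lemma z_ub_hat0 y : (z_ub y == hat0 A) = (y == Qmin).
Proof.
apply/eqP/eqP => [|-> //]; have [->//|->//|[F Fu ->]] := QposetP y.
by rewrite z_ub_Qface.
Qed.

Lemma z_ub_face y X : X != empty_flat A -> z_ub y = BElt X ->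
  exists F, [/\ ~~ face_bounded F, y = Qface F & face_hull F = X].
Proof.
move=> X0; have [->|->//|[F Fu ->]] := QposetP y.
  by move=> e; rewrite -(BElt_inj e) eqxx in X0.
by rewrite z_ub_Qface// => e; exists F; split=> //; exact: BElt_inj e.
Qed.

Lemma le_Qmin y : (Qmin <= y)%O.
Proof.
have [->|->|[F Fu ->]] := QposetP y; [by []|by []|].
have -> : (Qmin <= Qface F)%O =
  ((BElt Top : (face_lattice A)^d) <=
   ub_val (insubd ub_min (BElt (TElt F) : (face_lattice A)^d)))%O by [].
by rewrite val_Qface.
Qed.

Lemma le_Qtop y : (y <= (Top : Qposet A))%O.
Proof. by case: y. Qed.

(** Above a nonempty flat, the fibre of [z_ub] consists of unbounded faces, so counts in [Qposet A]
    become counts of faces. *)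
Lemma card_Qfaces (q : pred (Qposet A)) (r : pred (face A)) X :
  X != empty_flat A ->
  (forall F, face_hull F = X ->
     (~~ face_bounded F && q (Qface F)) = r F) ->
  #|[pred y | (z_ub y == BElt X) && q y]| =
  #|[pred F | r F && (face_hull F == X)]|.
Proof.
move=> X0 qr.
have inj : {in [pred F | r F && (face_hull F == X)] &, injective Qface}.
  move=> F G; rewrite !inE => /andP[rF /eqP FX] /andP[rG /eqP GX].
  by apply: Qface_inj; rewrite inE; [move: rF|move: rG]; rewrite -qr// => /andP[].
rewrite -(card_in_imset inj); apply: fintype.eq_card => y.
rewrite inE; apply/andP/imsetP => [[/eqP/(z_ub_face X0)[F [Fu -> FX]] qy]|[F]].
  by exists F; rewrite // inE FX eqxx andbT -qr// Fu.
rewrite inE => /andP[rF /eqP FX] ->; move: rF; rewrite -qr// => /andP[Fu qF].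
by rewrite z_ub_Qface// FX.
Qed.

Lemma card_lower_hat0 y : z_ub y != hat0 A ->
  #|[pred y' | (z_ub y' == hat0 A) && (y' < y)%O]| = 1%N.
Proof.
move=> y0; rewrite -(card1 Qmin); apply: fintype.eq_card => y'.
rewrite !inE z_ub_hat0; case: eqP => //= ->.
by rewrite lt_neqAle le_Qmin andbT eq_sym -z_ub_hat0.
Qed.

Lemma card_lower_hat1 y X : essential A -> X != empty_flat A ->
  z_ub y = hat1 A ->
  #|[pred y' | (z_ub y' == BElt X) && (y' < y)%O]|%:Z =
  Zint_ub (@int_rank0 R n A) (BElt X) (hat1 A).
Proof.
move=> ess X0 /eqP; rewrite z_ub_hat1 => /eqP ->.
rewrite -card_unbounded_faces//; congr Posz; apply: card_Qfaces => // F _.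
by rewrite lt_neqAle le_Qtop !andbT.
Qed.

Lemma card_lower y X Y : (X < Y)%O -> Y != empty_flat A -> z_ub y = BElt Y ->
  #|[pred y' | (z_ub y' == BElt X) && (y' < y)%O]|%:Z =
  Zint (@int_rank0 R n A) (BElt X) (BElt Y).
Proof.
move=> XY Y0 /(z_ub_face Y0)[G [Gu -> GY]].
have X0 : X != empty_flat A.
  by apply: contraTneq XY => ->; rewrite (le_gtF (le_empty_flat Y)).
rewrite -GY -card_star_faces ?GY ?ltW//; congr Posz.
apply: (card_Qfaces X0) => F FX.
apply/andP/idP => [[Fu /ltW]|GF]; first by rewrite le_Qface.
(* Since [G] is unbounded, unboundedness of [F] is automatic and [card_star_faces] counts the right
   set. *)
have Fu : ~~ face_bounded F by apply: contra Gu; exact: face_bounded_le.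
split=> //; rewrite lt_neqAle le_Qface// GF andbT.
apply: contraTneq XY => /Qface_inj; rewrite !inE => /(_ Fu Gu) FG.
by rewrite -FX -GY FG ltxx.
Qed.

End UnboundedPoset.

(** * Counting the chains of unbounded faces over a given chain *)

Theorem theorem4p2 (R : realType) (n : nat) (A : arrangement R n)
    (k : nat) (x : k.+1.-tuple (int_lattice0 A)) :
  essential A -> noncentral A -> (2 <= k)%N ->
  sorted <%O x -> nth (hat0 A) x 0 = hat0 A -> nth (hat0 A) x k = hat1 A ->
  #|[pred y : k.+1.-tuple (Qposet A) |
      sorted <%O y && [forall i, z_ub (tnth y i) == tnth x i]]|%:Z =
  (\prod_(2 <= i < k)
      Zint (@int_rank0 R n A) (nth (hat0 A) x i.-1) (nth (hat0 A) x i)) *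
  Zint_ub (@int_rank0 R n A) (nth (hat0 A) x k.-1) (nth (hat0 A) x k).
Proof.
move=> ess _; case: k x => [|[|k]] // x _ x_sorted x0 xk.
pose xi i := nth (hat0 A) x i.
have xlt i : (i < k.+2)%N -> (xi i < xi i.+1)%O.
  by move=> ik; move/(sortedP (hat0 A)): x_sorted; apply; rewrite size_tuple ltnS.
have xle i j : (i <= j)%N -> (j < k.+3)%N -> (xi i <= xi j)%O.
  move=> ij jk; apply: (sorted_leq_nth le_trans lexx (hat0 A)) => //.
  - by move: x_sorted; rewrite lt_sorted_uniq_le => /andP[].
  - by rewrite inE size_tuple; lia.
  - by rewrite inE size_tuple.
(* Entries strictly between [hat0] and [hat1] are nonempty flats. *)
have xiE i : (0 < i < k.+2)%N -> exists2 X, xi i = BElt X & X != empty_flat A.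
  move=> /andP[i0 ik]; have := xlt i ik; have := xle _ _ ik (ltnSn _).
  rewrite {2}/xi xk; have : (hat0 A < xi i)%O.
    by rewrite -x0; apply: lt_le_trans (xlt 0%N isT) _; apply: xle => //; exact: ltnW.
  case: (xi i) => [|X]; first by rewrite ltxx.
  move=> _ le1 lt1; exists X => //; apply: contraTneq lt1 => ->.
  by rewrite (le_gtF le1).
(* [c i] is the number of choices for the entry [i] below a fixed entry [i.+1]: one for the minimum,
   [Z_ub] just below the maximum, [Z] in between. *)
pose c (i : nat) : int := if i == 0%N then 1 else
  if i == k.+1 then Zint_ub (@int_rank0 R n A) (xi i) (xi i.+1)
  else Zint (@int_rank0 R n A) (xi i) (xi i.+1).
transitivity (\prod_(0 <= i < k.+2) c i); last first.
  rewrite big_nat_recl// big_nat_recr//= {1}/c mul1r; congr (_ * _); last first.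
    by rewrite /c /= eqxx.
  rewrite -[2%N in RHS]add0n big_addn subn2 /=; apply: eq_big_nat => i ik.
  by rewrite /c /= eqSS ltn_eqF// addn2.
rewrite -(@card_sorted_fibers _ (@Order.lt _ (Qposet A)) k.+2
  (fun i y => z_ub y == xi i) c).
- congr Posz; apply: fintype.eq_card => y; rewrite !inE; congr (_ && _).
  by apply: eq_forallb => i; rewrite (tnth_nth (hat0 A) x).
- rewrite -(card1 (Top : Qposet A)); apply: fintype.eq_card => y.
  by rewrite !inE [LHS]/in_mem /= /xi xk z_ub_hat1.
move=> i y ik /eqP yi; rewrite /c; case: i ik yi => [|i] ik yi.
  rewrite /= /xi x0 card_lower_hat0// yi -x0.
  by rewrite gt_eqF//; exact: xlt.
have [X XE X0] := xiE i.+1 ik; rewrite XE /=.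
case: (eqVneq i.+1 k.+1) => [[ik1]|ik1].
  by rewrite ik1 /xi xk in yi *; exact: card_lower_hat1.
have [|Y YE Y0] := xiE i.+2; first by lia.
rewrite YE; apply: card_lower => //; last by rewrite yi.
by have := xlt i.+1 ik; rewrite XE YE.
Qed.
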